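(* Let $CI(N)$ denote the number of isomorphism classes of graphs among the $I$-graphs $I(n,j,k)$ with $3 \leq n \leq N$ (and $1 \leq k \leq n/2$, $1 \leq j \leq k$). Then $$CI(N) \sim \frac{5}{16} N^2 \quad \text{as } N \to \infty.$$
   Context: For integers $n \geq 3$, $1 \leq k \leq n/2$, $1 \leq j \leq k$, the $I$-graph $I(n,j,k)$ has vertex set $\{a_i, b_i : 0 \leq i \leq n-1\}$ and edge set $\{a_i a_{i+j}, a_i b_i, b_i b_{i+k} : 0 \leq i \leq n-1\}$, subscripts modulo $n$. $f(N) \sim g(N)$ means $f(N)/g(N) \to 1$. *)

(* Defs.v *)
From HB Require Import structures.
From mathcomp Require Import all_boot all_order all_algebra.
From mathcomp Require Import all_classical all_reals all_analysis.
Set Implicit Arguments.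
Unset Strict Implicit.
Unset Printing Implicit Defensive.
Import Order.TTheory GRing.Theory Num.Theory.
Import numFieldNormedType.Exports.

Record graph := Graph { vertex :> finType; adj : rel vertex }.
Arguments adj : clear implicits.

Definition simple (G : graph) : Prop :=
  symmetric (adj G) /\ irreflexive (adj G).

Definition graph_iso (G H : graph) : Prop :=
  exists f : G -> H, bijective f /\ forall x y, adj H (f x) (f y) = adj G x y.

Lemma graph_iso_refl G : graph_iso G G.
Proof. by exists id; split=> //; exists id. Qed.

Lemma graph_iso_sym G H : graph_iso G H -> graph_iso H G.
Proof.
move=> [f [[g fK gK] fP]]; exists g; split; first by exists f.
by move=> x y; rewrite -fP !gK.
Qed.

Lemma graph_iso_trans G H K : graph_iso G H -> graph_iso H K -> graph_iso G K.
Proof.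
move=> [f [fB fP]] [g [gB gP]]; exists (g \o f); split; first exact: bij_comp.
by move=> x y; rewrite /= gP fP.
Qed.

(* [inl i] is the vertex a_i and [inr i] is the vertex b_i.  Adjacency is the
   symmetric closure of the listed pairs; edges that coincide as unordered
   pairs (which happens when 2j = n or 2k = n) are a single edge. *)
Definition Igraph_adj (n j k : nat) : rel ('I_n + 'I_n) := fun u v =>
  match u, v with
  | inl i, inl i' => (i + j == i' %[mod n]) || (i' + j == i %[mod n])
  | inr i, inr i' => (i + k == i' %[mod n]) || (i' + k == i %[mod n])
  | inl i, inr i' | inr i, inl i' => i == i'
  end.

Definition Igraph (n j k : nat) : graph := Graph (@Igraph_adj n j k).

Definition Iparam (n j k : nat) : bool :=
  [&& 3 <= n, 1 <= k, 2 * k <= n, 1 <= j & j <= k].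

Lemma Igraph_simple n j k : Iparam n j k -> simple (Igraph n j k).
Proof.
move=> /and5P[n3 k1 k2 j1 jk]; split.
  by move=> [i|i] [i'|i'] /=; first [exact: orbC | exact: eq_sym].
have E (i : 'I_n) m : 0 < m -> 2 * m <= n -> (i + m == i %[mod n]) = false.
  move=> m0 mn; rewrite -[X in _ == X %[mod n]]addn0 eqn_modDl mod0n modn_small.
    by rewrite eqn0Ngt m0.
  by apply: leq_trans mn; rewrite mul2n -addnn -[X in X < _]addn0 ltn_add2l.
by case=> i /=; rewrite E //; apply: leq_trans k2; rewrite leq_mul2l.
Qed.

(* Triples are (n, j, k); j <= k <= n <= N, so bounding all three by N loses
   nothing. *)
Definition Iparams (N : nat) : {set 'I_N.+1 * 'I_N.+1 * 'I_N.+1} :=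
  [set t : 'I_N.+1 * 'I_N.+1 * 'I_N.+1 | Iparam t.1.1 t.1.2 t.2].

Definition Igraph_isob (N : nat) : rel ('I_N.+1 * 'I_N.+1 * 'I_N.+1) :=
  fun s t => `[< graph_iso (Igraph s.1.1 s.1.2 s.2) (Igraph t.1.1 t.1.2 t.2) >].

Lemma Igraph_isob_equiv N : equivalence_rel (@Igraph_isob N).
Proof.
apply/equivalence_relP; split=> [s|s t].
  by apply/asboolP; exact: graph_iso_refl.
move=> /asboolP st u; apply/asboolP/asboolP; apply: graph_iso_trans => //.
exact: graph_iso_sym.
Qed.

Definition CI (N : nat) : nat :=
  #|equivalence_partition (@Igraph_isob N) (Iparams N)|.

Local Open Scope ring_scope.
Local Open Scope classical_set_scope.

Definition asymp_equiv (R : realType) (f g : nat -> R) : Prop :=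
  f N / g N @[N --> \oo] --> (1 : R).

(* Main.v *)
(* A graph I(n,j,k) is governed by the lattice L of relations
   {(x,y) in Z^2 : n | xj + yk}.  When L contains no short nonzero vector, every
   closed reduced 8-walk alternates spokes and rim edges; hence an isomorphism
   preserves spokes, acts on positions by an affine map, and n together with L,
   up to sign changes and the swap of coordinates, is an isomorphism invariant.
   Conversely equal lattices give parameters that differ by a unit modulo n.
   Writing L in Hermite normal form <(a,b),(0,c)> with gcd(a,b,c) = 1 and
   n = m a c, the classes are counted, up to the factor 4 and an error
   O(#{(m,a,c) : m a c <= N}) = o(N^2) due to short or symmetric lattices, by the
   quadruples (m,a,b,c) with m a c <= N, b < c and gcd(a,b,c) = 1.  Their number
   is asymptotic to zeta(2)^2 / (2 zeta(4)) N^2, and zeta(2)^2 = (5/2) zeta(4) by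
   Zagier's telescoping identity. *)
Require Import Defs.
From HB Require Import structures.
From mathcomp Require Import all_boot all_order all_algebra.
From mathcomp Require Import all_classical all_reals all_analysis.
From mathcomp Require Import zify ring lra.
Set Implicit Arguments.
Unset Strict Implicit.
Unset Printing Implicit Defensive.
Import Order.TTheory GRing.Theory Num.Theory.
Import numFieldNormedType.Exports.

(** * Counting Hermite normal forms *)

(** The quotient of Z^2 by L is the subgroup of Z/n generated by j and k. Hence [a c] is the order
    of that subgroup, [m] is its index, which is also the number of components of the graph, and
    gcd(a,b,c) = 1 says that the quotient is cyclic. The signed permutations of the two coordinates
    act on lattices and -1 acts trivially, so an orbit has four elements unless the lattice is
    symmetric: this is the factor 4. An exact isomorphism criterion for all parameters would be
    delicate. Since only o(N^2) has to be controlled, the exceptional lattices are merely counted: a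
    short vector leaves boundedly many b for given (m,a,c), and a symmetric lattice is determined,
    up to boundedly many choices, by some such triple. *)

Lemma sum_ord_support (K L : nat) (F : nat -> nat) : L <= K ->
  (forall x, L <= x -> F x = 0) -> \sum_(i < K) F i = \sum_(i < L) F i.
Proof.
move=> LK H; rewrite (big_ord_widen K F LK) [RHS]big_mkcond.
by apply: eq_bigr => i _; case: ltnP => // /H.
Qed.

(** Reindexing by [x = g * i] may keep the range [K]: the surplus indices have [g * i >= K], where
    [F] vanishes. *)
Lemma sum_dilate (g K : nat) (F : nat -> nat) : 0 < g ->
  (forall x, ~~ (g %| x) -> F x = 0) -> (forall x, K <= x -> F x = 0) ->
  \sum_(i < K) F i = \sum_(i < K) F (g * i).
Proof.
move=> g0 Fg FK.
transitivity (\sum_(i < K) \sum_(i' < K | i == g * i' :> nat) F i).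
  apply: eq_bigr => i _; case: (boolP (g %| i)) => [/dvdnP[q iE]|/Fg->]; last first.
    by rewrite big1.
  have qK : q < K by apply: leq_ltn_trans (ltn_ord i); rewrite iE leq_pmulr.
  rewrite (eq_bigl (fun i' : 'I_K => i' == q :> nat)); last first.
    by move=> i'; rewrite iE mulnC eqn_pmul2l // eq_sym.
  by rewrite (big_ord1_eq _ (fun _ => F i)) qK.
rewrite (exchange_big_dep xpredT) //=; apply: eq_bigr => i' _.
by rewrite (big_ord1_eq _ F); case: ltnP => // /FK.
Qed.

(** Hermite forms of determinant at most [M] and content exactly [g]. The box [K] is separate from
    [M] so that different contents are summed over the same ranges. *)
Definition hnf_count (g K M : nat) : nat :=
  \sum_(a < K) \sum_(c < K) \sum_(b < K)
    ([&& 0 < a, b < c, a * c <= M & gcdn a (gcdn b c) == g] : nat).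

Lemma hnf_count_widen g K M : M < K -> hnf_count g K M = hnf_count g M.+1 M.
Proof.
move=> MK; rewrite /hnf_count.
pose f a c b : nat := [&& 0 < a, b < c, a * c <= M & gcdn a (gcdn b c) == g].
rewrite (sum_ord_support (F := fun a => \sum_(c < K) \sum_(b < K) f a c b) MK); last first.
  move=> x Mx; rewrite big1 // => c _; rewrite big1 // => b _; rewrite /f.
  by case: and4P => // -[]; nia.
apply: eq_bigr => a _.
rewrite (sum_ord_support (F := fun c => \sum_(b < K) f a c b) MK); last first.
  move=> x Mx; rewrite big1 // => b _; rewrite /f.
  by case: and4P => // -[]; nia.
apply: eq_bigr => c _.
rewrite (sum_ord_support (F := fun b => f a c b) MK) // => x Mx; rewrite /f.
by case: and4P => // -[]; nia.
Qed.

(** Dividing [a], [b] and [c] by the content [g] gives a primitive form and divides the determinant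
    [a * c] by [g ^ 2]. *)
Lemma hnf_count_scale g K M : 0 < g -> M < K ->
  hnf_count g K M = hnf_count 1 K (M %/ g ^ 2).
Proof.
move=> g0 MK; rewrite /hnf_count.
pose f a c b : nat := [&& 0 < a, b < c, a * c <= M & gcdn a (gcdn b c) == g].
have fa a c b : ~~ (g %| a) -> f a c b = 0.
  by rewrite /f; case: and4P => // -[_ _ _ /eqP <-]; rewrite dvdn_gcdl.
have fc a c b : ~~ (g %| c) -> f a c b = 0.
  rewrite /f; case: and4P => // -[_ _ _ /eqP <-].
  by rewrite (dvdn_trans (dvdn_gcdr _ _)) ?dvdn_gcdr.
have fb a c b : ~~ (g %| b) -> f a c b = 0.
  rewrite /f; case: and4P => // -[_ _ _ /eqP <-].
  by rewrite (dvdn_trans (dvdn_gcdr _ _)) ?dvdn_gcdl.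
rewrite (sum_dilate (F := fun a => \sum_(c < K) \sum_(b < K) f a c b) g0); last first.
- move=> x Kx; rewrite big1 // => c _; rewrite big1 // => b _; rewrite /f.
  by case: and4P => // -[]; nia.
- by move=> x gx; rewrite big1 // => c _; rewrite big1 // => b _; exact: fa.
apply: eq_bigr => a _.
rewrite (sum_dilate (F := fun c => \sum_(b < K) f (g * a) c b) g0); last first.
- move=> x Kx; rewrite big1 // => b _; rewrite /f.
  by case: and4P => // -[]; nia.
- by move=> x gx; rewrite big1 // => b _; exact: fc.
apply: eq_bigr => c _.
rewrite (sum_dilate (F := fun b => f (g * a) (g * c) b) g0); last first.
- move=> x Kx; rewrite /f.
  by case: and4P => // -[]; nia.
- by move=> x gx; exact: fb.
apply: eq_bigr => b _; rewrite /f; congr nat_of_bool.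
rewrite muln_gt0 g0 ltn_pmul2l // -!muln_gcdr -[X in _ == X]muln1 eqn_pmul2l //.
by rewrite mulnACA leq_divRL ?expn_gt0 ?g0 // mulnn mulnC.
Qed.

Definition hnf_all (K M : nat) : nat :=
  \sum_(a < K) \sum_(c < K) \sum_(b < K) ([&& 0 < a, b < c & a * c <= M] : nat).

Lemma hnf_all_gcd K M : M < K ->
  hnf_all K M = \sum_(1 <= g < M.+1) hnf_count g K M.
Proof.
move=> MK; rewrite /hnf_count /hnf_all.
rewrite [RHS]exchange_big /=; apply: eq_bigr => a _.
rewrite [RHS]exchange_big /=; apply: eq_bigr => c _.
rewrite [RHS]exchange_big /=; apply: eq_bigr => b _.
case: and3P => [[a0 bc ac]|H]; last first.
  by rewrite big1 // => g _; case: and4P => // -[? ? ? _]; case: H.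
rewrite (eq_bigr (fun g => (g == gcdn a (gcdn b c)) : nat)); last first.
  by move=> g _; rewrite a0 bc ac eq_sym.
rewrite -big_mkcond /= (big_nat1_eq _ (fun=> 1)) gcdn_gt0 a0 /=.
have : gcdn a (gcdn b c) <= a by rewrite dvdn_leq // dvdn_gcdl.
by case: ltnP => //; nia.
Qed.

Lemma hnf_all_tri K M : M < K ->
  hnf_all K M = \sum_(1 <= a < M.+1) \sum_(1 <= c < (M %/ a).+1) c.
Proof.
move=> MK; rewrite /hnf_all.
rewrite (sum_ord_support (F := fun a => \sum_(c < K) \sum_(b < K)
   ([&& 0 < a, b < c & a * c <= M] : nat)) MK); last first.
  move=> x Mx; rewrite big1 // => c _; rewrite big1 // => b _.
  by case: and3P => // -[]; nia.
rewrite -(big_mkord xpredT (fun a => \sum_(c < K) \sum_(b < K)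
   ([&& 0 < a, b < c & a * c <= M] : nat))) big_ltn // big1 ?add0n; last first.
  by move=> c _; rewrite big1.
apply: eq_big_nat => a /andP[a0 aM].
have aK : M %/ a < K by apply: leq_ltn_trans (leq_div _ _) MK.
rewrite (sum_ord_support (F := fun c => \sum_(b < K)
   ([&& 0 < a, b < c & a * c <= M] : nat)) aK); last first.
  move=> x Mx; rewrite big1 // => b _; case: and3P => // -[_ _].
  by rewrite mulnC -leq_divRL // leqNgt Mx.
rewrite -(big_mkord xpredT (fun c => \sum_(b < K)
   ([&& 0 < a, b < c & a * c <= M] : nat))) big_ltn // big1 ?add0n; last first.
  by move=> b _; rewrite ltn0 andbF.
apply: eq_big_nat => c /andP[c0]; rewrite ltnS leq_divRL // mulnC => acM.
have cK : c <= K by nia.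
rewrite a0 acM /= -[RHS](card_ord c) -sum1_card (big_ord_widen K (fun=> 1) cK).
by rewrite [RHS]big_mkcond; apply: eq_bigr => b _; rewrite andbT; case: ltnP.
Qed.

(** * Covering bounds and the finite sets to be counted *)

Lemma card_le_cover (T I : finType) (E : {set T}) (A : {set I}) (F : I -> {set T}) K :
  (forall t, t \in E -> exists2 i, i \in A & t \in F i) ->
  (forall i, i \in A -> #|F i| <= K) -> #|E| <= K * #|A|.
Proof.
move=> cov FK; have sub : E \subset \bigcup_(i in A) F i.
  by apply/fintype.subsetP => t /cov[i iA tF]; apply/finset.bigcupP; exists i.
apply: leq_trans (subset_leq_card sub) _; rewrite mulnC -sum_nat_const.
apply: (@leq_trans (\sum_(i in A) #|F i|)); last exact: leq_sum.
elim/big_rec2: _ => [|i x B _ IH]; first by rewrite cards0.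
by apply: leq_trans (leq_card_setU _ _) _; rewrite leq_add2l.
Qed.

(** The products [p * b] share their residue modulo [c], so [b] is determined by the quotient
    [p * b %/ c], which is below [p]. *)
Lemma card_dvd_le (K c p : nat) (A : {set 'I_K}) : 0 < p ->
  (forall b, b \in A -> b < c) ->
  (forall b b' : 'I_K, b \in A -> b' \in A -> (c%:Z %| (p%:Z * b%:Z - p%:Z * b'%:Z)%R)%Z) ->
  #|A| <= p.
Proof.
case: p => // p _ Ac Ad.
have q_lt b : b \in A -> p.+1 * b %/ c < p.+1.
  move=> bA; have bc := Ac b bA; rewrite ltn_divLR; last by apply: leq_ltn_trans bc.
  by rewrite ltn_pmul2l.
have inj : {in A &, injective (fun b : 'I_K => inord (p.+1 * b %/ c) : 'I_p.+1)}.
  move=> b b' bA bA' /(congr1 (@nat_of_ord _)); rewrite !inordK ?q_lt // => qE.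
  have : p.+1 * b = p.+1 * b' %[mod c].
    apply/eqP; have := Ad b b' bA bA'; rewrite -eqz_mod_dvd -!PoszM !modz_nat.
    by move=> /eqP[->].
  move=> rE; apply: val_inj; apply/eqP; rewrite -(eqn_pmul2l (ltn0Sn p)).
  by rewrite (divn_eq (p.+1 * b) c) qE rE -divn_eq.
by rewrite -(card_in_imset inj) (leq_trans (max_card _)) // card_ord.
Qed.

Notation tok N := (('I_N.+1 * 'I_N.+1) * ('I_N.+1 * 'I_N.+1))%type.

(* [((m, a), (c, b))] stands for the lattice spanned by (a, b) and (0, c), for
   the graphs with n = m a c. *)
Definition hnfs N : {set tok N} :=
  [set t : tok N | [&& 0 < t.1.1, 0 < t.1.2, t.2.2 < t.2.1,
     t.1.1 * t.1.2 * t.2.1 <= N & gcdn t.1.2 (gcdn t.2.2 t.2.1) == 1]].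

Definition toksize N (t : tok N) : nat := t.1.1 * t.1.2 * t.2.1.

(** Tokens without [b]. Every exceptional set is bounded by a constant times the number of these
    triples. *)
Definition facs N : {set ('I_N.+1 * 'I_N.+1) * 'I_N.+1} :=
  [set t : ('I_N.+1 * 'I_N.+1) * 'I_N.+1 |
    [&& 0 < t.1.1, 0 < t.1.2, 0 < t.2 & t.1.1 * t.1.2 * t.2 <= N]].

Lemma card_set_sum (T : finType) (P : pred T) : #|[set x | P x]| = \sum_x (P x : nat).
Proof. by rewrite cardsE -sum1_card big_mkcond. Qed.

Lemma sum_nat_pos K (F : nat -> nat) : F 0 = 0 ->
  \sum_(i < K.+1) F i = \sum_(1 <= i < K.+1) F i.
Proof. by move=> F0; rewrite -(big_mkord xpredT F) big_ltn // F0. Qed.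

Lemma card_hnfs N : #|hnfs N| = \sum_(1 <= m < N.+1) hnf_count 1 (N %/ m).+1 (N %/ m).
Proof.
rewrite card_set_sum.
pose f (m a c b : nat) : nat :=
  [&& 0 < m, 0 < a, b < c, m * a * c <= N & gcdn a (gcdn b c) == 1].
transitivity (\sum_(m < N.+1) \sum_(a < N.+1) \sum_(c < N.+1) \sum_(b < N.+1) f m a c b).
  rewrite pair_bigA /= [RHS](eq_bigr (fun p : 'I_N.+1 * 'I_N.+1 =>
    \sum_(q : 'I_N.+1 * 'I_N.+1) f p.1 p.2 q.1 q.2)); last first.
    by move=> p _; rewrite pair_bigA.
  by rewrite pair_bigA.
rewrite (sum_nat_pos N (F := fun m : nat => \sum_(a < N.+1) \sum_(c < N.+1) \sum_(b < N.+1) f m a c b)).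
  apply: eq_big_nat => m /andP[m0 _].
  rewrite -(hnf_count_widen 1 (K := N.+1)) ?ltnS ?leq_div //.
  apply: eq_bigr => a _; apply: eq_bigr => c _; apply: eq_bigr => b _.
  by rewrite /f m0 leq_divRL // [a * c * m]mulnC mulnA.
by do 3 (rewrite big1 // => ? _).
Qed.

Lemma sum_ltn_ord K n : n <= K -> \sum_(i < K.+1) ((0 < i) && (i <= n) : nat) = n.
Proof.
move=> nK; rewrite (sum_nat_pos K (F := fun i => (0 < i) && (i <= n) : nat)) //.
rewrite (@big_cat_nat _ _ _ n.+1) //= [X in _ + X]big_nat_cond [X in _ + X]big1 ?addn0.
  rewrite (eq_big_nat _ _ (F2 := fun=> 1)) ?sum_nat_const_nat ?subn1 ?muln1 //.
  by move=> i /andP[-> /=]; rewrite ltnS => ->.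
by move=> i /andP[/andP[ni _] _]; rewrite [i <= n]leqNgt ni andbF.
Qed.

Lemma card_facs N : #|facs N| =
  \sum_(1 <= m < N.+1) \sum_(1 <= a < (N %/ m).+1) (N %/ m) %/ a.
Proof.
rewrite card_set_sum.
pose f (m a c : nat) : nat := [&& 0 < m, 0 < a, 0 < c & m * a * c <= N].
transitivity (\sum_(m < N.+1) \sum_(a < N.+1) \sum_(c < N.+1) f m a c).
  by rewrite pair_bigA /= pair_bigA.
rewrite (sum_nat_pos N (F := fun m : nat => \sum_(a < N.+1) \sum_(c < N.+1) f m a c)).
  apply: eq_big_nat => m /andP[m0 mN].
  have mN' : (N %/ m).+1 <= N.+1 by rewrite ltnS leq_div.
  rewrite (sum_ord_support (F := fun a : nat => \sum_(c < N.+1) f m a c) mN'); last first.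
    move=> a aN; rewrite big1 // => c _; rewrite /f; case: and4P => // -[_ _ c0 H].
    by move: aN; rewrite leqNgt ltnS leq_divRL // mulnC (leq_trans _ H) // leq_pmulr.
  rewrite (sum_nat_pos _ (F := fun a : nat => \sum_(c < N.+1) f m a c)).
    apply: eq_big_nat => a /andP[a0 aN].
    rewrite -(@sum_ltn_ord N (N %/ m %/ a)); last first.
      by apply: leq_trans (leq_div _ _) (leq_div _ _).
    apply: eq_bigr => c _; rewrite /f m0 a0 /= -divnMA leq_divRL ?muln_gt0 ?m0 //.
    by rewrite mulnC.
  by rewrite big1 // => c _; rewrite /f andbF.
by do 2 (rewrite big1 // => ? _).
Qed.

Local Open Scope ring_scope.

(** * Quadratic asymptotics of divisor sums *)

Section Asymptotics.
Variable R : realType.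
Implicit Types (u v : nat -> R) (w : nat -> nat) (N m n : nat) (l e K Z : R).

(** This is o(N^2), with a bound at every positive [N] instead of beyond a threshold, because it
    gets applied to all quotients [N %/ m] at once. The linear term makes room for a constant summed
    over [m <= N]. *)
Definition small u : Prop := forall e, 0 < e ->
  exists2 K, 0 <= K & forall N, (0 < N)%N -> `|u N| <= e * N%:R ^+ 2 + K * N%:R.

Lemma eq_small u v : u =1 v -> small u -> small v.
Proof. by move=> E su e /su[K K0 H]; exists K => // N /H; rewrite E. Qed.

Lemma smallD u v : small u -> small v -> small (fun N => u N + v N).
Proof.
move=> su sv e e0; have e2 : 0 < e / 2 by lra.
have [K K0 HK] := su _ e2; have [L L0 HL] := sv _ e2.
exists (K + L) => [|N N0]; first lra.
have := HK N N0; have := HL N N0; have := ler_normD (u N) (v N).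
by rewrite mulrDl; move: (N%:R ^+ 2) => x; lra.
Qed.

Lemma smallZ l u : small u -> small (fun N => l * u N).
Proof.
move=> su e e0; have l0 : 0 < `|l| + 1 by have := normr_ge0 l; lra.
have [K K0 HK] := su (e / (`|l| + 1)) (divr_gt0 e0 l0).
exists ((`|l| + 1) * K) => [|N N0]; first by rewrite mulr_ge0 // ltW.
rewrite normrM; apply: (@le_trans _ _ ((`|l| + 1) * `|u N|)).
  by rewrite ler_wpM2r // lerDl.
apply: le_trans (ler_wpM2l (ltW l0) (HK N N0)) _.
have -> : (`|l| + 1) * (e / (`|l| + 1) * N%:R ^+ 2 + K * N%:R) =
  e * N%:R ^+ 2 + (`|l| + 1) * K * N%:R by field; rewrite gt_eqF.
by [].
Qed.

Lemma small_id : small (fun N => N%:R).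
Proof.
move=> e e0; exists 1 => // N N0; rewrite normr_nat mul1r lerDr.
by rewrite mulr_ge0 ?exprn_ge0 // ltW.
Qed.

Lemma small_le u v : (forall N, (0 < N)%N -> `|u N| <= `|v N|) -> small v -> small u.
Proof.
by move=> H sv e /sv[K K0 HK]; exists K => // N N0; exact: le_trans (H N N0) (HK N N0).
Qed.

(** Completing the square trades the linear term for a constant. A constant error in each of [N]
    summands then restores the linear term that [small] allows. *)
Lemma small_const u : small u -> forall e, 0 < e ->
  exists2 K, 0 <= K & forall N, (0 < N)%N -> `|u N| <= e * N%:R ^+ 2 + K.
Proof.
move=> su e e0; have e2 : 0 < e / 2 by lra.
have [K K0 HK] := su _ e2; exists (K ^+ 2 / (2 * e)).
  by rewrite divr_ge0 ?exprn_ge0 //; lra.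
move=> N N0; apply: le_trans (HK N N0) _; set x := N%:R.
have -> : e * x ^+ 2 + K ^+ 2 / (2 * e) =
  e / 2 * x ^+ 2 + K * x + (e * x - K) ^+ 2 / (2 * e) by field; rewrite gt_eqF.
by rewrite lerDl divr_ge0 ?sqr_ge0 //; lra.
Qed.

(** Partial sums of zeta(2) for [w = id] and of zeta(4) for [w] the squaring map. *)
Definition zpart w N : R := \sum_(1 <= m < N.+1) ((w m)%:R ^+ 2)^-1.

(** Telescopes, as 1/(p+1)^2 is at most 1/(p(p+1)) = 1/p - 1/(p+1). *)
Lemma zpart_tail_le w M N : (forall m, m <= w m)%N -> (0 < M)%N -> (M <= N)%N ->
  \sum_(M.+1 <= m < N.+1) ((w m)%:R ^+ 2)^-1 <= M%:R^-1 - N%:R^-1 :> R.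
Proof.
move=> wle M0 /subnK <-; elim: (N - M)%N => [|d IH].
  by rewrite add0n big_geq // subrr.
rewrite addSn big_nat_recr /=; last by rewrite ltnS leq_addl.
apply: le_trans (lerD IH (lexx _)) _.
set p := (d + M)%N; have p0 : (0 : R) < p%:R by rewrite ltr0n addn_gt0 M0 orbT.
have wp : (p.+1%:R : R) <= (w p.+1)%:R by rewrite ler_nat.
have p1 : (0 : R) < p.+1%:R by rewrite ltr0n.
have : ((w p.+1)%:R ^+ 2)^-1 <= p%:R^-1 - p.+1%:R^-1 :> R.
  apply: (@le_trans _ _ ((p.+1%:R ^+ 2)^-1)).
    rewrite lef_pV2 ?posrE ?exprn_gt0 ?(lt_le_trans p1) //.
    by rewrite ler_sqr ?nnegrE.
  have -> : p%:R^-1 - p.+1%:R^-1 = (p%:R * p.+1%:R)^-1 :> R.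
    by rewrite -natr1; field; rewrite natr1 !gt_eqF.
  by rewrite expr2 lef_pV2 ?posrE ?mulr_gt0 // ler_wpM2r ?ltW // ltr_nat.
by move=> H; rewrite -addrA lerD2l addrC -lerBrDr opprK addrC.
Qed.

(** The sum of the series, characterised by its rate of convergence, which is what the estimates
    use. *)
Definition zlim w Z : Prop := forall N, (0 < N)%N -> 0 <= Z - zpart w N <= N%:R^-1.

Lemma zlim_ex w : (forall m, m <= w m)%N -> exists Z, zlim w Z.
Proof.
move=> wle.
have nd : nondecreasing_seq (zpart w).
  apply/nondecreasing_seqP => N; rewrite /zpart [leRHS]big_nat_recr //= lerDl invr_ge0.
  by rewrite exprn_ge0.
have split M N : (M <= N)%N -> zpart w N = zpart w M + \sum_(M.+1 <= m < N.+1) ((w m)%:R ^+ 2)^-1.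
  by move=> MN; rewrite /zpart -big_cat_nat.
have bd M N : (0 < M)%N -> (M <= N)%N -> zpart w N <= zpart w M + M%:R^-1.
  move=> M0 MN; rewrite (split M N MN) lerD2l.
  apply: le_trans (zpart_tail_le wle M0 MN) _.
  by rewrite lerBlDr lerDl invr_ge0.
have cv : cvgn (zpart w).
  apply: nondecreasing_is_cvgn => //; exists (zpart w 1%N + 1%:R^-1) => _ [N _ <-].
  case: (posnP N) => [->|N0]; last exact: bd.
  by apply: le_trans (nd 0%N 1%N _) _ => //; rewrite lerDl invr_ge0.
exists (limn (zpart w)) => N N0; rewrite subr_ge0 nondecreasing_cvgn_le //=.
rewrite lerBlDr addrC; apply: limr_le => //.
by exists N => // M /= NM; exact: bd.
Qed.

(** Compare m^-2 with 1/(m^2 - 1/4) = 1/(m - 1/2) - 1/(m + 1/2), which telescopes from 2/3 at m =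
    2. *)
Lemma sum_inv_sqr_le N : \sum_(2 <= m < N.+1) (m%:R ^+ 2)^-1 <= 2 / 3 :> R.
Proof.
suff H n : \sum_(2 <= m < n.+2) (m%:R ^+ 2)^-1 <= 2 / 3 - 2 / (2 * n%:R + 3) :> R.
  case: N => [|n]; first by rewrite big_geq //; lra.
  have : 0 <= 2 / (2 * n%:R + 3) :> R by rewrite divr_ge0 // addr_ge0 // mulr_ge0.
  have := H n; lra.
elim: n => [|n IH]; first by rewrite big_geq // mulr0 add0r subrr.
rewrite big_nat_recr //=; apply: le_trans (lerD IH (lexx _)) _.
have -> : n.+2%:R = n%:R + 2 :> R by rewrite -addn2 natrD.
have -> : n.+1%:R = n%:R + 1 :> R by rewrite natr1.
have : (0 : R) <= n%:R by []; move: (n%:R : R) => x x0.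
have -> : 2 / 3 - 2 / (2 * (x + 1) + 3) =
   2 / 3 - 2 / (2 * x + 3) + ((x + 2) ^+ 2 - 4^-1)^-1 by field; rewrite !gt_eqF //; nra.
by rewrite lerD2l lef_pV2 ?posrE; nra.
Qed.

Lemma zpart_le w N : (forall m, m <= w m)%N -> zpart w N <= 2.
Proof.
move=> wle; apply: (@le_trans _ _ (\sum_(1 <= m < N.+1) (m%:R ^+ 2)^-1)).
  apply: ler_sum_nat => m /andP[m0 _]; have m0' : (0 : R) < m%:R by rewrite ltr0n.
  have wp : (m%:R : R) <= (w m)%:R by rewrite ler_nat.
  rewrite lef_pV2 ?posrE ?exprn_gt0 ?(lt_le_trans m0') //.
  by rewrite ler_sqr ?nnegrE.
case: N => [|N]; first by rewrite big_geq.
rewrite big_ltn //; have := sum_inv_sqr_le N.+1; rewrite expr1n invr1; lra.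
Qed.

(** With [w = id] this sums over an additional factor, with [w] the squaring map over the content of
    a form. The range stops at [N] because [w m >= m] in all uses. *)
Definition dconv w u N : R := \sum_(1 <= m < N.+1) u (N %/ w m)%N.

Lemma natr_div_le N m : (0 < m)%N -> (N %/ m)%:R <= N%:R / m%:R :> R.
Proof. by move=> m0; rewrite ler_pdivlMr ?ltr0n // -natrM ler_nat leq_trunc_div. Qed.

Lemma natr_div_gt N m : (0 < m)%N -> N%:R / m%:R < (N %/ m)%:R + 1 :> R.
Proof.
by move=> m0; rewrite ltr_pdivrMr ?ltr0n // natr1 -natrM ltr_nat ltn_ceil.
Qed.

(** The quadratic errors are weighted by the inverse squares of [w m], whose sum is at most 2; the
    constant errors add up to [K * N]. *)
Lemma dconv_small w u : (forall m, m <= w m)%N -> u 0%N = 0 -> small u -> small (dconv w u).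
Proof.
move=> wle u0 su e e0; have e2 : 0 < e / 2 by lra.
have [K K0 HK] := small_const su e2; exists K => // N N0.
have -> : e * N%:R ^+ 2 + K * N%:R = (e / 2 * N%:R ^+ 2) * 2 + K *+ N.
  by rewrite mulr_natr; congr (_ + _); field.
have -> : K *+ N = \sum_(1 <= m < N.+1) K by rewrite sumr_const_nat subn1.
apply: le_trans (ler_norm_sum _ _ _) _.
apply: (@le_trans _ _ (e / 2 * N%:R ^+ 2 * zpart w N + \sum_(1 <= m < N.+1) K)); last first.
  by rewrite lerD2r ler_wpM2l ?zpart_le // mulr_ge0 ?exprn_ge0 // ltW.
rewrite /zpart mulr_sumr -big_split /=; apply: ler_sum_nat => m /andP[m0 _].
have w0 : (0 < w m)%N by exact: leq_trans m0 (wle m).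
(* [small] bounds nothing at 0, so the terms with [w m > N] rely on [u 0 = 0]. *)
case: (posnP (N %/ w m)%N) => [->|d0].
  by rewrite u0 normr0 addr_ge0 // !mulr_ge0 ?invr_ge0 ?exprn_ge0 // ltW.
apply: le_trans (HK _ d0) _; rewrite lerD2r -[leRHS]mulrA ler_wpM2l ?(ltW e2) // -exprVn -exprMn.
by rewrite ler_sqr ?nnegrE ?mulr_ge0 ?invr_ge0 // natr_div_le.
Qed.

Lemma dconv_sqr w Z : (forall m, m <= w m)%N -> zlim w Z ->
  small (fun N => dconv w (fun m => m%:R ^+ 2) N - Z * N%:R ^+ 2).
Proof.
move=> wle wZ e e0; have e2 : 0 < e / 2 by lra.
exists (2 / e + 1) => [|N N0]; first by rewrite addr_ge0 // divr_ge0 // ltW.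
have /andP[t0 t1] := wZ N N0.
have N0' : (0 : R) < N%:R by rewrite ltr0n.
have -> : dconv w (fun m => m%:R ^+ 2) N - Z * N%:R ^+ 2 =
  (dconv w (fun m => m%:R ^+ 2) N - zpart w N * N%:R ^+ 2) -
  (Z - zpart w N) * N%:R ^+ 2 by ring.
have H1 : `|(Z - zpart w N) * N%:R ^+ 2| <= N%:R.
  rewrite ger0_norm ?mulr_ge0 ?exprn_ge0 //.
  apply: le_trans (ler_wpM2r (exprn_ge0 _ _) t1) _ => //.
  by rewrite expr2 mulKf ?gt_eqF.
have H2 : `|dconv w (fun m => m%:R ^+ 2) N - zpart w N * N%:R ^+ 2| <=
    e * N%:R ^+ 2 + 2 / e * N%:R.
  rewrite /dconv /zpart mulr_suml -sumrB.
  apply: le_trans (ler_norm_sum _ _ _) _.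
  apply: (@le_trans _ _ (e / 2 * N%:R ^+ 2 * zpart w N + \sum_(1 <= m < N.+1) (2 / e))); last first.
    rewrite sumr_const_nat subn1 -[2 / e *+ _]mulr_natr /= lerD2r.
    have -> : e * N%:R ^+ 2 = e / 2 * N%:R ^+ 2 * 2 by field.
    by rewrite ler_wpM2l ?zpart_le // mulr_ge0 ?exprn_ge0 // ltW.
  rewrite /zpart mulr_sumr -big_split /=; apply: ler_sum_nat => m /andP[m0 _].
  have w0 : (0 < w m)%N by exact: leq_trans m0 (wle m).
  have := natr_div_le N w0; have := natr_div_gt N w0.
  have E1 : ((w m)%:R ^+ 2)^-1 * N%:R ^+ 2 = (N%:R / (w m)%:R) ^+ 2 :> R.
    by rewrite -exprVn mulrC -exprMn.
  rewrite E1 -[_ * _ * _^-1]mulrA [_ ^+ 2 / _]mulrC E1.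
  set y := N%:R / (w m)%:R; set d := (N %/ w m)%:R => yd dy.
  have d0 : (0 : R) <= d by [].
  rewrite distrC ger0_norm; last by nra.
  (* Rounding costs at most [2 * y]. Instead of summing this to N log N, it is split into a summable
     multiple of [y ^ 2] and a constant. *)
  have -> : e / 2 * y ^+ 2 + 2 / e = 2 * y + (e * y - 2) ^+ 2 / (2 * e).
    by field; rewrite gt_eqF.
  have : 0 <= (e * y - 2) ^+ 2 / (2 * e) by rewrite divr_ge0 ?sqr_ge0 //; lra.
  by nra.
apply: le_trans (ler_normB _ _) _.
have -> : (2 / e + 1) * N%:R = 2 / e * N%:R + N%:R by rewrite mulrDl mul1r.
by rewrite addrA lerD.
Qed.

Lemma dconvB w u v N : dconv w (fun m => u m - v m) N = dconv w u N - dconv w v N.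
Proof. by rewrite /dconv sumrB. Qed.

Lemma dconvZ w u l N : dconv w (fun m => l * u m) N = l * dconv w u N.
Proof. by rewrite /dconv mulr_sumr. Qed.

Lemma dconv_quadratic w Z u l : (forall m, m <= w m)%N -> zlim w Z -> u 0%N = 0 ->
  small (fun N => u N - l * N%:R ^+ 2) ->
  small (fun N => dconv w u N - l * Z * N%:R ^+ 2).
Proof.
move=> wle wZ u0 su.
have s1 : small (dconv w (fun N => u N - l * N%:R ^+ 2)).
  by apply: dconv_small => //; rewrite u0 expr0n mulr0 subr0.
have s2 := smallZ l (dconv_sqr wle wZ).
apply: eq_small (smallD s1 s2) => N.
by rewrite dconvB dconvZ; ring.
Qed.

(* The terms [m >= 2] of the convolution contract by [\sum_(m >= 2) m^-2 <= 2/3]. *)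
Lemma dconv_sqr_inv u : u 0%N = 0 -> small (dconv (fun m => m ^ 2)%N u) -> small u.
Proof.
move=> u0 su e e0; have e3 : 0 < e / 3 by lra.
(* The bound B = e N^2 + 3 K N reproduces itself: (e/3) N^2 + K plus two thirds of B is at most
   B. *)
have [K K0 HK] := small_const su e3; exists (3 * K) => [|N]; first lra.
elim/ltn_ind: N => N IH N0.
have E : u N = dconv (fun m => m ^ 2)%N u N - \sum_(2 <= m < N.+1) u (N %/ m ^ 2)%N.
  by rewrite /dconv big_ltn // exp1n divn1 addrK.
have B : `|\sum_(2 <= m < N.+1) u (N %/ m ^ 2)%N| <=
    (e * N%:R ^+ 2 + 3 * K * N%:R) * (2 / 3).
  apply: (@le_trans _ _ ((e * N%:R ^+ 2 + 3 * K * N%:R) *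
     \sum_(2 <= m < N.+1) (m%:R ^+ 2)^-1)); last first.
    rewrite ler_wpM2l ?sum_inv_sqr_le //.
    by rewrite addr_ge0 ?mulr_ge0 ?exprn_ge0 // ?ltW //; lra.
  apply: le_trans (ler_norm_sum _ _ _) _; rewrite mulr_sumr.
  apply: ler_sum_nat => m /andP[m2 _]; have m0 : (0 < m)%N by exact: ltnW.
  have m20 : (0 < m ^ 2)%N by rewrite expn_gt0 m0.
  have Hm : (1 : R) <= m%:R ^+ 2 by rewrite -natrX ler1n.
  case: (posnP (N %/ m ^ 2)%N) => [->|d0].
    rewrite u0 normr0 mulr_ge0 ?invr_ge0 ?exprn_ge0 //.
    by rewrite addr_ge0 ?mulr_ge0 ?exprn_ge0 // ?ltW //; lra.
  have lt : (N %/ m ^ 2 < N)%N by rewrite ltn_Pdiv // -(exp1n 2) ltn_exp2r.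
  apply: le_trans (IH _ lt d0) _.
  have dle := natr_div_le N m20; rewrite natrX in dle.
  set M := m%:R ^+ 2 in Hm dle *; set x := N%:R in dle *; set d := (N %/ _)%:R in dle *.
  have x0 : 0 <= x by []. have d0' : 0 <= d by [].
  have M0 : 0 < M by lra.
  have i0 : 0 < M^-1 by rewrite invr_gt0.
  have i1 : M^-1 <= 1 by rewrite invf_le1.
  rewrite [leRHS]mulrDl lerD //.
    rewrite -mulrA ler_wpM2l ?(ltW e0) //; apply: (@le_trans _ _ ((x / M) ^+ 2)).
      by rewrite ler_sqr ?nnegrE ?divr_ge0 // ltW.
    by rewrite exprMn ler_wpM2l ?sqr_ge0 // expr2 ler_piMl // ltW.
  by rewrite -[leRHS]mulrA ler_wpM2l // mulr_ge0.
rewrite E; apply: le_trans (ler_normB _ _) _.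
have := HK N N0; have : K <= K * N%:R by rewrite ler_peMr // ler1n.
move: B; set S := `|\sum_(_ <= _ < _) _|; set S' := `|dconv _ _ _|.
move: (N%:R ^+ 2) => x2; move: (K * N%:R) (3 * K * N%:R) (mulrA 3 K N%:R) => kn kn3 <-; lra.
Qed.

End Asymptotics.

(** * zeta(2)^2 = (5/2) zeta(4) *)

Section Zeta.
Variable R : realType.
Implicit Types (x y : R) (N n : nat).

(** Symmetric, and equal to (5/2) n^-4 on the diagonal, which is the source of the factor 5/2. *)
Definition zagier x y : R := (x * y ^+ 3)^-1 + (2 * x ^+ 2 * y ^+ 2)^-1 + (x ^+ 3 * y)^-1.

Lemma zagierE x y : 0 < x -> 0 < y ->
  zagier x y - zagier (x + y) y - zagier (x + y) x = (x ^+ 2)^-1 * (y ^+ 2)^-1.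
Proof.
by move=> x0 y0; rewrite /zagier; field; rewrite !gt_eqF //= addr_gt0.
Qed.

(** Boundary terms: the shifted pairs [(x + y, y)] with [y <= N < x + y], which leave the square of
    side [N]. *)
Definition zagier_rem N : R :=
  \sum_(1 <= n < N.+1) \sum_(1 <= t < n.+1) zagier (N%:R + t%:R) n%:R.

(** When [zagierE] is summed over the square, the shifted terms cancel the off-diagonal ones,
    leaving the diagonal and the boundary. Induction on [N] replaces the reindexing of double
    sums. *)
Lemma zagier_sum N : zpart R id N ^+ 2 =
  5 / 2 * zpart R (fun m => m ^ 2)%N N - 2 * zagier_rem N.
Proof.
elim: N => [|N IH]; first by rewrite /zpart /zagier_rem !big_geq // expr0n /= !mulr0 subrr.
rewrite /zpart !(big_nat_recr N.+1) //= -!/(zpart _ _ _).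
set p : R := N.+1%:R; have p0 : 0 < p by rewrite ltr0n.
(* Raising [N] by one moves the window of first arguments: one term enters at the top and one leaves
   at the bottom. *)
have shift n : \sum_(1 <= t < n.+1) zagier (p + t%:R) n%:R =
    \sum_(1 <= t < n.+1) zagier (N%:R + t%:R) n%:R + zagier (p + n%:R) n%:R - zagier p n%:R.
  pose g t := zagier (N%:R + t%:R) n%:R.
  have E t : zagier (p + t%:R) n%:R = g t.+1 by rewrite /g /p -!natr1 addrAC addrA.
  under eq_bigr do rewrite E.
  have E1 : zagier p n%:R = g 1%N by rewrite /g natr1.
  have -> : \sum_(1 <= t < n.+1) g t.+1 = \sum_(2 <= t < n.+2) g t by rewrite [RHS]big_add1.
  rewrite E E1.
  have : \sum_(1 <= t < n.+2) g t = \sum_(1 <= t < n.+1) g t + g n.+1 by rewrite big_nat_recr.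
  by rewrite big_ltn // => <-; rewrite [X in _ = X - _]addrC addrK.
have remE : zagier_rem N.+1 = zagier_rem N - p ^- 2 * zpart R id N -
    \sum_(1 <= n < N.+1) zagier (p + n%:R) p +
    \sum_(1 <= t < N.+2) zagier (p + t%:R) p.
  rewrite {1}/zagier_rem big_nat_recr //=; congr (_ + _).
  rewrite /zagier_rem /zpart mulr_sumr -!sumrB; apply: eq_big_nat => n /andP[n0 _].
  by rewrite shift -zagierE ?ltr0n //; ring.
rewrite remE (big_nat_recr N.+1) //= -/p.
have Ep : zagier (p + p) p = 3 / 4 * p ^- 4.
  by rewrite /zagier -[p + p]mulr2n -mulr_natl; field; rewrite gt_eqF.
rewrite Ep sqrrD IH natrX -/p.
by field; rewrite gt_eqF.
Qed.

(** First arguments are at least N and N >= n, so each of the n terms of row n is at most (5/2)/(N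
    n^3). The rows sum to (5/2)/N times a partial sum of zeta(2), which is at most 2. *)
Lemma zagier_rem_le N : (0 < N)%N -> 0 <= zagier_rem N <= 5 / N%:R.
Proof.
move=> N0; have N0' : (0 : R) < N%:R by rewrite ltr0n.
have H n t : (0 < n)%N -> (n <= N)%N ->
   0 <= zagier (N%:R + t%:R) n%:R <= 5 / 2 / (N%:R * n%:R ^+ 3).
  move=> n0 nN; have n0' : (0 : R) < n%:R by rewrite ltr0n.
  have nN' : n%:R <= N%:R :> R by rewrite ler_nat.
  have : (0 : R) <= t%:R by []; move: (t%:R : R) => s s0.
  have x0 : 0 < N%:R + s by lra.
  apply/andP; split.
    by rewrite /zagier !addr_ge0 ?invr_ge0 ?mulr_ge0 ?exprn_ge0 // ltW.
  have -> : 5 / 2 / (N%:R * n%:R ^+ 3) = (N%:R * n%:R ^+ 3)^-1 +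
    (2 * (N%:R * n%:R ^+ 3))^-1 + (N%:R * n%:R ^+ 3)^-1 :> R.
    by field; rewrite !gt_eqF.
  have P1 : (0 : R) < N%:R * n%:R ^+ 3 by rewrite mulr_gt0 ?exprn_gt0.
  have Nx : N%:R <= N%:R + s by lra.
  have nx : n%:R <= N%:R + s by lra.
  rewrite /zagier; move: (N%:R : R) (n%:R : R) N0' n0' nN' x0 P1 Nx nx => a b a0 b0 ab x0 P1 ax bx.
  set x := a + s in x0 ax bx *.
  have b2 : 0 <= b ^+ 2 by rewrite exprn_ge0 // ltW.
  have L2 : a * b ^+ 3 <= x ^+ 2 * b ^+ 2.
    rewrite exprS mulrA ler_wpM2r // expr2; apply: ler_pM => //; exact: ltW.
  apply: lerD; first apply: lerD.
  - by rewrite lef_pV2 ?posrE ?mulr_gt0 ?exprn_gt0 // ler_wpM2r // exprn_ge0 // ltW.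
  - rewrite lef_pV2 ?posrE ?mulr_gt0 ?exprn_gt0 //.
    by rewrite -mulrA ler_wpM2l.
  - rewrite lef_pV2 ?posrE ?mulr_gt0 ?exprn_gt0 //.
    apply: le_trans L2 _; rewrite [b ^+ 2]expr2 mulrA ler_wpM2r ?(ltW b0) //.
    by rewrite [leRHS]exprSr ler_wpM2l ?exprn_ge0 // ltW.
apply/andP; split.
  rewrite /zagier_rem big_seq sumr_ge0 // => n; rewrite mem_index_iota => /andP[n0 nN].
  by apply: sumr_ge0 => t _; case/andP: (H n t n0 nN).
apply: (@le_trans _ _ (5 / 2 / N%:R * zpart R id N)); last first.
  have -> : 5 / N%:R = 5 / 2 / N%:R * 2 :> R by field; rewrite gt_eqF.
  by rewrite ler_wpM2l ?zpart_le // divr_ge0 //; lra.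
rewrite /zpart mulr_sumr; apply: ler_sum_nat => n /andP[n0 nN].
have n0' : (0 : R) < n%:R by rewrite ltr0n.
have -> : 5 / 2 / N%:R * (n%:R ^+ 2)^-1 =
    \sum_(1 <= t < n.+1) (5 / 2 / (N%:R * n%:R ^+ 3)) :> R.
  rewrite sumr_const_nat subn1 /= -[_ *+ n]mulr_natr.
  by field; rewrite !gt_eqF.
by apply: ler_sum_nat => t _; case/andP: (H n t n0 nN).
Qed.

Lemma zeta2_sqr (Z2 Z4 : R) : zlim id Z2 -> zlim (fun m => m ^ 2)%N Z4 ->
  Z2 ^+ 2 = 5 / 2 * Z4.
Proof.
move=> H2 H4; set D := `|Z2 ^+ 2 - 5 / 2 * Z4|.
(* The errors are at most 5/N from the square of zeta(2), 10/N from [zagier_rem] and 5/(2N) from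
   zeta(4). *)
have B N : (0 < N)%N -> D <= 20 / N%:R.
  move=> N0; have /andP[a0 a1] := H2 N N0; have /andP[b0 b1] := H4 N N0.
  have /andP[r0 r1] := zagier_rem_le N0.
  have z2 : zpart R id N <= 2 by exact: zpart_le.
  have z0 : 0 <= zpart R id N.
    by apply: sumr_ge0 => m _; rewrite invr_ge0 exprn_ge0.
  have := zagier_sum N; rewrite /D.
  have i1 : N%:R^-1 <= 1 :> R by rewrite invf_le1 ?ltr0n // ler1n.
  move: (zpart R (fun m => m ^ 2)%N N) (zpart R _ N) (zagier_rem N) (N%:R^-1) a0 a1 b0 b1 r0 r1 z2 z0 i1.
  move=> y z r i a0 a1 b0 b1 r0 r1 z2 z0 i1 E.
  have q1 : Z2 ^+ 2 - z ^+ 2 <= 5 * i.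
    have -> : Z2 ^+ 2 - z ^+ 2 = (Z2 - z) * (2 * z + (Z2 - z)) by ring.
    move: (Z2 - z) a0 a1 => a a0 a1.
    have h : 0 <= a * (5 - (2 * z + a)) by apply: mulr_ge0; lra.
    by lra.
  have q0 : 0 <= Z2 ^+ 2 - z ^+ 2.
    by rewrite subr_ge0 ler_sqr ?nnegrE //; lra.
  by rewrite ler_norml; apply/andP; split; lra.
apply/eqP; rewrite -subr_eq0 -normr_eq0 -/D eq_le normr_ge0 andbT leNgt.
apply/negP => D0; have q0 : 0 <= 20 / D by rewrite divr_ge0 // ltW.
have := archi_boundP q0; set M := Num.bound _ => HM.
have M0 : (0 < M)%N by rewrite -(ltr0n R) (le_lt_trans q0).
have := B M M0; rewrite ler_pdivlMr ?ltr0n // leNgt.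
by move: HM; rewrite ltr_pdivrMr // mulrC => ->.
Qed.
End Zeta.

(** * Density of primitive Hermite forms *)

Section Densities.
Variable R : realType.

Definition hnfR (M : nat) : R := (hnf_count 1 M.+1 M)%:R.

Lemma hnfR0 : hnfR 0 = 0.
Proof.
rewrite /hnfR /hnf_count big1 // => a _; rewrite big1 // => c _; rewrite big1 // => b _.
by case: and4P => // -[]; nia.
Qed.

Definition triR (n : nat) : R := (\sum_(1 <= c < n.+1) c)%:R.

Lemma triR_small : small (fun n => triR n - 2^-1 * n%:R ^+ 2).
Proof.
apply: eq_small (smallZ (2^-1 : R) (@small_id R)) => n; rewrite /triR.
suff -> : (\sum_(1 <= c < n.+1) c)%:R = 2^-1 * (n%:R * (n%:R + 1)) :> R by ring.
elim: n => [|n IH]; first by rewrite big_geq // mul0r mulr0.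
by rewrite big_nat_recr //= natrD IH -natr1; field.
Qed.

(** Both sides count all forms with [a * c <= M], on the left by content and on the right by [a]. *)
Lemma dconv_hnfR M : dconv (fun m => m ^ 2)%N hnfR M = dconv id triR M.
Proof.
rewrite /dconv -!natr_sum; congr (_%:R).
have <- := hnf_all_tri (ltnSn M); rewrite hnf_all_gcd //.
apply: eq_big_nat => g /andP[g0 _]; rewrite (hnf_count_scale g0) //.
by rewrite -(hnf_count_widen 1 (K := M.+1)) // ltnS leq_div.
Qed.

Lemma leq_sqr m : (m <= m ^ 2)%N.
Proof. by case: m => // m; rewrite -mulnn leq_pmulr. Qed.

(** The sum over [a] of triangular numbers gives zeta(2)/2, inverting the sum over contents divides
    by zeta(4), and the sum over [m] contributes another zeta(2). *)
Lemma dconv_hnfR_small : small (fun N => dconv id hnfR N - 5 / 4 * N%:R ^+ 2).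
Proof.
have [Z2 H2] := zlim_ex R (w := id) (fun m => leqnn m).
have [Z4 H4] := zlim_ex R leq_sqr.
have Z4_gt0 : 0 < Z4.
  have /andP[+ _] := H4 1%N isT.
  by rewrite /zpart big_nat1 exp1n expr1n invr1 subr_ge0; apply: lt_le_trans.
have Z24 := zeta2_sqr H2 H4.
have S0 : small (fun N => dconv (fun m => m ^ 2)%N
    (fun M => hnfR M - 2^-1 * Z2 / Z4 * M%:R ^+ 2) N).
  have t0 : triR 0 = 0 by rewrite /triR big_geq.
  have S1 := dconv_quadratic (fun m => leqnn m) H2 t0 triR_small.
  have S2 := smallZ (- (2^-1 * Z2 / Z4)) (dconv_sqr leq_sqr H4).
  apply: eq_small (smallD S1 S2) => N; rewrite dconvB dconvZ dconv_hnfR.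
  by field; rewrite gt_eqF.
have S3 : small (fun M => hnfR M - 2^-1 * Z2 / Z4 * M%:R ^+ 2).
  by apply: dconv_sqr_inv S0; rewrite hnfR0 expr0n mulr0 subr0.
apply: eq_small (dconv_quadratic (fun m => leqnn m) H2 hnfR0 S3) => N.
congr (_ - _ * _).
have -> : 2^-1 * Z2 / Z4 * Z2 = Z2 ^+ 2 / (2 * Z4) by field; rewrite gt_eqF.
by rewrite Z24; field; rewrite gt_eqF.
Qed.
End Densities.

Section Real.
Variable R : realType.

Lemma card_hnfs_small : small (fun N => #|hnfs N|%:R - 5 / 4 * N%:R ^+ 2 : R).
Proof.
apply: eq_small (@dconv_hnfR_small R) => N; congr (_ - _).
by rewrite card_hnfs /dconv natr_sum.
Qed.

(** The triples are a twice iterated divisor sum of the linear function, and convolution preserves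
    smallness. *)
Lemma card_facs_small : small (fun N => #|facs N|%:R : R).
Proof.
have S1 : small (dconv id (dconv id (fun N => N%:R : R))).
  apply: dconv_small => //; first by rewrite /dconv big_geq.
  by apply: dconv_small => //; exact: small_id.
apply: eq_small S1 => N; rewrite card_facs /dconv natr_sum.
by apply: eq_bigr => m _; rewrite natr_sum.
Qed.
End Real.

(** * Isomorphisms between graphs without short relations *)

Definition lat (V : zmodType) (j k : V) (x y : int) : bool :=
  j *~ x + k *~ y == 0.

(** A walk of eight steps displaces each coordinate by at most 8. *)
Definition Lgood (L : int -> int -> bool) : Prop :=
  forall x y : int, `|x| <= 8 -> `|y| <= 8 -> L x y -> x = 0 /\ y = 0.

Definition sg (s : bool) : int := if s then -1 else 1.
Arguments sg : simpl never.

Lemma mulr_sgT (V : zmodType) (x : V) : x *~ sg true = - x.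
Proof. by rewrite /sg mulrNz mulr1z. Qed.

Lemma mulr_sgF (V : zmodType) (x : V) : x *~ sg false = x.
Proof. exact: mulr1z. Qed.

Definition mulr_sg := (mulr_sgT, mulr_sgF).

(** The four values of [g] represent the signed permutations of the generators modulo simultaneous
    negation, which preserves the lattice. *)
Definition act (V : zmodType) (g : bool * bool) (p : V * V) : V * V :=
  let q := (p.1 *~ sg g.1, p.2) in if g.2 then (q.2, q.1) else q.

Section Vgraph.
Variables (V : finZmodType) (j k : V).
Implicit Types (v : bool * V) (s l : bool).

(** I-graphs over any finite abelian group, so that arithmetic enters only through [lat j k]. The
    vertex [(false, x)] stands for a_x and [(true, x)] for b_x. *)
Definition stp l : V := if l then k else j.
Definition spoke v : bool * V := (~~ v.1, v.2).
Definition rim v s : bool * V := (v.1, v.2 + stp v.1 *~ sg s).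
Definition across v s : bool * V := (v.1, v.2 + stp (~~ v.1) *~ sg s).

Definition Vadj : rel (bool * V) := fun u v =>
  if u.1 == v.1 then (v.2 == u.2 + stp u.1) || (u.2 == v.2 + stp u.1)
  else u.2 == v.2.
Definition Vgraph := Graph Vadj.

Definition move (d : option bool) v := if d is Some s then rim v s else spoke v.

Lemma adj_move u v : reflect (exists d, v = move d u) (Vadj u v).
Proof.
apply: (iffP idP); case: u => lu xu; case: v => lv xv; rewrite /Vadj /=.
  case: eqP => [<-|ne].
    case/orP=> /eqP->; first by exists (Some false); rewrite /= /rim mulr_sg.
    by exists (Some true); rewrite /= /rim mulr_sg /= addrK.
  by move=> /eqP->; exists None; rewrite /spoke /=; case: lu lv ne => [] [].
case=> -[[]|] [-> ->].
- by rewrite eqxx mulr_sg subrK eqxx orbT.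
- by rewrite eqxx mulr_sg eqxx.
- by case: lu => /=; rewrite eqxx.
Qed.

Lemma adj_spoke v : Vadj v (spoke v).
Proof. by apply/adj_move; exists None. Qed.

Lemma adj_rim v s : Vadj v (rim v s).
Proof. by apply/adj_move; exists (Some s). Qed.

Lemma acrossE v s : across v s = spoke (rim (spoke v) s).
Proof. by rewrite /across /spoke /rim /= negbK. Qed.

Lemma spokeK : involutive spoke.
Proof. by case=> l x; rewrite /spoke /= negbK. Qed.

Lemma rimK v s : rim (rim v s) (~~ s) = v.
Proof.
by case: v => l x; case: s; rewrite /rim /= !mulr_sg ?subrK ?addrK.
Qed.

Lemma rim_across v s t : rim (across v t) s = across (rim v s) t.
Proof. by rewrite /rim /across /= addrAC. Qed.

(** Lift of a walk to the cover by Z^2: final side and net numbers of [j] and [k] steps. *)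
Fixpoint disp (w : seq (option bool)) (l : bool) (p q : int) : bool * int * int :=
  if w is d :: w' then
    match d with
    | None => disp w' (~~ l) p q
    | Some s => if l then disp w' l p (q + sg s) else disp w' l (p + sg s) q
    end
  else (l, p, q).

Lemma foldl_move w l x p q :
  foldl (fun v d => move d v) (l, x + j *~ p + k *~ q) w =
  let: (l', p', q') := disp w l p q in (l', x + j *~ p' + k *~ q').
Proof.
elim: w l p q => [|[s|] w IH] l p q //=.
  have E1 : x + j *~ p + k *~ q + k *~ sg s = x + j *~ p + k *~ (q + sg s).
    by rewrite mulrzDr addrA.
  have E2 : x + j *~ p + k *~ q + j *~ sg s = x + j *~ (p + sg s) + k *~ q.
    by rewrite mulrzDr addrA [RHS]addrAC.
  by rewrite /rim /=; case: l => /=; rewrite ?E1 ?E2 IH.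
by rewrite /spoke /= IH.
Qed.

(** Three consecutive vertices of a cyclically reduced closed 8-walk. Vertices may repeat; excluding
    only backtracking makes this a condition on the word of moves. *)
Definition closed8 (G : graph) (u v w : G) : Prop :=
  exists x3 x4 x5 x6 x7 : G,
   [/\ [/\ adj G u v, adj G v w, adj G w x3 & adj G x3 x4],
       [/\ adj G x4 x5, adj G x5 x6, adj G x6 x7 & adj G x7 u],
       [/\ u <> w, v <> x3, w <> x4 & x3 <> x5] &
       [/\ x4 <> x6, x5 <> x7, x6 <> u & x7 <> v]].

End Vgraph.

Lemma closed8_iso (G H : graph) (f : G -> H) (u v w : G) :
  injective f -> (forall x y, adj H (f x) (f y) = adj G x y) ->
  closed8 u v w -> closed8 (f u) (f v) (f w).
Proof.
move=> fI fP [x3 [x4 [x5 [x6 [x7 [[? ? ? ?] [? ? ? ?] [? ? ? ?] [? ? ? ?]]]]]]].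
exists (f x3), (f x4), (f x5), (f x6), (f x7).
by split; split; rewrite ?fP //; move=> /fI.
Qed.

Definition alld (P : option bool -> bool) :=
  [&& P None, P (Some true) & P (Some false)].

Lemma alldP P : alld P -> forall d, P d.
Proof. by case/and3P=> ? ? ? [[]|]. Qed.

Definition backtrack (d e : option bool) : bool :=
  match d, e with
  | None, None => true
  | Some s, Some t => s != t
  | _, _ => false
  end.

Definition reduced8 (d0 d1 d2 d3 d4 d5 d6 d7 : option bool) : bool :=
  [&& ~~ backtrack d0 d1, ~~ backtrack d1 d2, ~~ backtrack d2 d3,
      ~~ backtrack d3 d4, ~~ backtrack d4 d5, ~~ backtrack d5 d6,
      ~~ backtrack d6 d7 & ~~ backtrack d7 d0].

Definition word_ok (l : bool) (d0 d1 d2 d3 d4 d5 d6 d7 : option bool) : bool :=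
  let: (l', p, q) := disp [:: d0; d1; d2; d3; d4; d5; d6; d7] l 0 0 in
  (reduced8 d0 d1 d2 d3 d4 d5 d6 d7 && (l' == l) && (p == 0) && (q == 0)) ==>
  ~~ (isSome d0 && isSome d1).

Lemma word_okP l d0 d1 d2 d3 d4 d5 d6 d7 : word_ok l d0 d1 d2 d3 d4 d5 d6 d7.
Proof.
have H : alld (fun d0 => alld (fun d1 => alld (fun d2 => alld (fun d3 =>
  alld (fun d4 => alld (fun d5 => alld (fun d6 => alld (fun d7 =>
  word_ok true d0 d1 d2 d3 d4 d5 d6 d7 &&
  word_ok false d0 d1 d2 d3 d4 d5 d6 d7)))))))).
  (* All 3^8 words on both sides are checked by computation. *)
  by vm_cast_no_check (erefl true).
move: H => /alldP/(_ d0)/alldP/(_ d1)/alldP/(_ d2)/alldP/(_ d3)/alldP/(_ d4).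
by move=> /alldP/(_ d5)/alldP/(_ d6)/alldP/(_ d7)/andP[] ? ?; case: l.
Qed.

Lemma disp_bound w l p q :
  let: (_, p', q') := disp w l p q in
  `|p'| <= `|p| + (size w)%:Z /\ `|q'| <= `|q| + (size w)%:Z.
Proof.
elim: w l p q => [|[s|] w IH] l p q /=; first by rewrite !addr0.
- case: l.
    have := IH true p (q + sg s); case: (disp _ _ _ _) => -[l' p' q'].
    by case: s; rewrite /sg; lia.
  have := IH false (p + sg s) q; case: (disp _ _ _ _) => -[l' p' q'].
  by case: s; rewrite /sg; lia.
- have := IH (~~ l) p q; case: (disp _ _ _ _) => -[l' p' q']; lia.
Qed.

Section Good.
Variables (V : finZmodType) (j k : V).
Hypothesis jk_good : Lgood (lat j k).
Notation rim := (rim j k).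
Notation across := (across j k).
Notation move := (move j k).

Lemma move_backtrack d e (v : bool * V) : backtrack d e -> move e (move d v) = v.
Proof.
case: d e => [s|] [t|] //= => [|_]; last exact: spokeK.
by move=> st; have -> : t = ~~ s by [case: s t st => [] []]; rewrite rimK.
Qed.

(* In the cover by Z^2 a reduced closed 8-walk alternates spokes and rim edges;
   goodness says that closed 8-walks lift to closed walks of the cover. *)
Lemma closed8_rim (u v w : Vgraph j k) :
  u.1 = v.1 -> v.1 = w.1 -> ~ closed8 u v w.
Proof.
move=> uv vw [x3 [x4 [x5 [x6 [x7 [[]]]]]]].
move=> /adj_move[d0 e0] /adj_move[d1 e1] /adj_move[d2 e2] /adj_move[d3 e3] [].
move=> /adj_move[d4 e4] /adj_move[d5 e5] /adj_move[d6 e6] /adj_move[d7 e7].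
move=> [n0 n1 n2 n3] [n4 n5 n6 n7].
have nb d e (x y z : bool * V) : y = move d x -> z = move e y -> x <> z ->
    ~~ backtrack d e.
  by move=> -> -> ne; apply/negP => /(@move_backtrack _ _ x) E; apply: ne.
have red : reduced8 d0 d1 d2 d3 d4 d5 d6 d7.
  rewrite /reduced8 (nb _ _ _ _ _ e0 e1 n0) (nb _ _ _ _ _ e1 e2 n1).
  rewrite (nb _ _ _ _ _ e2 e3 n2) (nb _ _ _ _ _ e3 e4 n3).
  rewrite (nb _ _ _ _ _ e4 e5 n4) (nb _ _ _ _ _ e5 e6 n5).
  by rewrite (nb _ _ _ _ _ e6 e7 n6) (nb _ _ _ _ _ e7 e0 n7).
have s0 : isSome d0.
  by case: d0 e0 {red} => // e0; move: uv; rewrite e0 /=; case: (u.1).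
have s1 : isSome d1.
  by case: d1 e1 {red} => // e1; move: vw; rewrite e1 /=; case: (v.1).
have := foldl_move j k [:: d0; d1; d2; d3; d4; d5; d6; d7] u.1 u.2 0 0.
have := disp_bound [:: d0; d1; d2; d3; d4; d5; d6; d7] u.1 0 0.
have := word_okP u.1 d0 d1 d2 d3 d4 d5 d6 d7; rewrite /word_ok.
case: (disp _ _ _ _) => -[l' p] q; rewrite red s0 s1 /= => ok [bp bq].
rewrite !mulr0z !addr0 -surjective_pairing -e0 -e1 -e2 -e3 -e4 -e5 -e6 -e7.
move=> E; have /= El := congr1 fst E; have /= := congr1 snd E.
move/eqP; rewrite -addrA -[X in X == _]addr0 (inj_eq (addrI _)) eq_sym => /(jk_good _ _)[].
- by move: bp; rewrite normr0 add0r.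
- by move: bq; rewrite normr0 add0r.
by move=> p0 q0; move: ok; rewrite p0 q0 El !eqxx.
Qed.

(** Two signs differ by at most 2, so a coincidence among the four elements [+-j +- k] would be a
    short relation. *)
Lemma rim_sign_uniq l (s t s' t' : bool) :
  stp j k l *~ sg s + stp j k (~~ l) *~ sg t =
  stp j k l *~ sg s' + stp j k (~~ l) *~ sg t' -> s = s' /\ t = t'.
Proof.
move=> /eqP; rewrite -subr_eq0 opprD addrACA -!mulrzBr => E.
have bd a b : `|sg a - sg b| <= 8 by case: a b => [] [].
have sgI a b : sg a - sg b = 0 -> a = b by case: a b => [] [].
case: l E => E; last first.
  by case: (jk_good _ _ E) => // /sgI -> /sgI ->.
by rewrite addrC in E; case: (jk_good _ _ E) => // /sgI -> /sgI ->.
Qed.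

Lemma rim_inj v : injective (rim v).
Proof.
move=> s t [E]; have /rim_sign_uniq[//] :
  stp j k v.1 *~ sg s + stp j k (~~ v.1) *~ sg true =
  stp j k v.1 *~ sg t + stp j k (~~ v.1) *~ sg true.
by congr (_ + _); apply: (addrI v.2).
Qed.
End Good.

(** The walk is the commutator of the translations by [j] and [k], with spokes between rim steps; it
    closes because the group is abelian. *)
Lemma closed8_spoke (V : finZmodType) (j k : V) (v : Vgraph j k) s :
  closed8 (spoke v : Vgraph j k) v (rim j k v s).
Proof.
pose x2 := rim j k v s; pose x3 := spoke x2; pose x4 := rim j k x3 false.
pose x5 := spoke x4; pose x6 := rim j k x5 (~~ s); pose x7 := spoke x6.
exists x3, x4, x5, x6, x7; case: v @x2 @x3 @x4 @x5 @x6 @x7 => l x /=.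
have nbl (b : bool) (y z : V) : (b, y) <> (~~ b, z) by case: b.
have nbl' (b : bool) (y z : V) : (~~ b, y) <> (b, z) by case: b.
split; split; rewrite ?/x7 ?/x6 ?/x5 ?/x4 ?/x3 ?/x2 /=; first
  [ exact: adj_rim | exact: adj_spoke | by rewrite /rim /spoke /= ?negbK;
    first [exact: nbl | exact: nbl'] | idtac].
- by apply/adj_move; exists None; rewrite /= spokeK.
- apply/adj_move; exists (Some true); rewrite /rim /spoke /=.
  congr pair; rewrite /= !negbK //.
  have -> : stp j k l *~ sg (~~ s) = - (stp j k l *~ sg s).
    by case: s; rewrite !mulr_sg ?opprK.
  by rewrite !mulr_sg (addrAC x) !addrK.
Qed.

Section Iso.
Variables (V : finZmodType) (j k j' k' : V).
Hypothesis jk_good : Lgood (lat j k).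
Hypothesis jk'_good : Lgood (lat j' k').
Variables (f : Vgraph j k -> Vgraph j' k') (g : Vgraph j' k' -> Vgraph j k).
Hypotheses (fK : cancel f g) (gK : cancel g f).
Hypothesis fP : forall x y, adj (Vgraph j' k') (f x) (f y) = adj (Vgraph j k) x y.

Let fI := can_inj fK.

Lemma rim_neq_spoke (v : bool * V) (i i' : V) s : rim i i' v s <> spoke v.
Proof. by case: v => -[] x. Qed.

(** If [f] sent a spoke at [v] to a rim edge, the opposite rim edge at [f v] would come from a rim
    edge at [v]. Spoke and rim edge lie on a reduced closed 8-walk by [closed8_spoke], their images
    do not by [closed8_rim]. *)
Lemma iso_spoke v : f (spoke v) = spoke (f v).
Proof.
have: adj (Vgraph j' k') (f v) (f (spoke v)) by rewrite fP; exact: adj_spoke.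
case/adj_move=> -[s|] // E.
pose w' : Vgraph j' k' := rim j' k' (f v) (~~ s).
have: adj (Vgraph j k) v (g w') by rewrite -fP gK; exact: adj_rim.
case/adj_move=> -[t|] Ew; last first.
  have : w' = f (spoke v) by rewrite -[spoke v]Ew gK.
  by rewrite E => /(rim_inj jk'_good); case: (s).
have := closed8_iso fI fP (closed8_spoke v t).
rewrite -[rim _ _ _ _]Ew gK E => /(closed8_rim jk'_good)-H.
by exfalso; apply: H.
Qed.

Lemma iso_rim v s : exists s', f (rim j k v s) = rim j' k' (f v) s'.
Proof.
have: adj (Vgraph j' k') (f v) (f (rim j k v s)) by rewrite fP; exact: adj_rim.
case/adj_move=> -[t|] E; first by exists t.
by move: E; rewrite /= -iso_spoke => /fI /rim_neq_spoke.
Qed.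

Lemma iso_rim_opp v s s' :
  f (rim j k v s) = rim j' k' (f v) s' -> f (rim j k v (~~ s)) = rim j' k' (f v) (~~ s').
Proof.
move=> E; have [t Et] := iso_rim v (~~ s).
have ts : t != s'.
  apply/eqP => ts; move: Et; rewrite ts -E => /fI /(rim_inj jk_good).
  by case: (s).
by rewrite Et; congr rim; case: t s' ts {E Et} => [] [].
Qed.

Lemma iso_across v t : exists t', f (across j k v t) = across j' k' (f v) t'.
Proof.
have [t' E] := iso_rim (spoke v) t; exists t'.
by rewrite !acrossE iso_spoke E iso_spoke.
Qed.

(** Seen from the end of the first step, the way back is known; [iso_rim_opp] then determines the
    way forward. *)
Lemma iso_rim_straight v s s' :
  f (rim j k v s) = rim j' k' (f v) s' ->
  f (rim j k (rim j k v s) s) = rim j' k' (f (rim j k v s)) s'.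
Proof.
move=> E; have [t Et] := iso_rim (rim j k v s) s.
rewrite Et; have := iso_rim_opp Et; rewrite rimK E => Ev.
congr rim; apply: negb_inj; apply: (rim_inj jk'_good (v := rim j' k' (f v) s')).
by rewrite -Ev rimK.
Qed.

Lemma iso_across_straight v s s' :
  f (across j k v s) = across j' k' (f v) s' ->
  f (across j k (across j k v s) s) = across j' k' (f (across j k v s)) s'.
Proof.
move=> E.
have E1 : f (rim j k (spoke v) s) = rim j' k' (f (spoke v)) s'.
  by apply: (inv_inj (@spokeK _)); rewrite -iso_spoke -acrossE E acrossE iso_spoke.
have H : spoke (across j k v s) = rim j k (spoke v) s by rewrite acrossE spokeK.
rewrite (acrossE _ _ (across j k v s)) H iso_spoke (iso_rim_straight E1).
by rewrite [RHS]acrossE -iso_spoke H.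
Qed.

(** At [v] the map [f] acts as an affine map whose linear part has the signs [s] and [t]. *)
Definition sheared s t v : Prop :=
  f (rim j k v false) = rim j' k' (f v) s /\ f (across j k v false) = across j' k' (f v) t.

(** A rim step and an across step commute, so the image of the far corner is computed in two ways;
    [rim_sign_uniq] forces opposite sides of the square to carry equal signs. *)
Lemma sheared_square s t v : sheared s t v ->
  sheared s t (rim j k v false) /\ sheared s t (across j k v false).
Proof.
move=> [Es Et]; have [s2 E2] := iso_rim (across j k v false) false.
have [t1 E1] := iso_across (rim j k v false) false.
have : across j' k' (f (rim j k v false)) t1 = rim j' k' (f (across j k v false)) s2.
  by rewrite -E1 -E2 rim_across.
rewrite Es Et => -[/eqP]; rewrite -!addrA (inj_eq (addrI _)) => /eqP.
rewrite [RHS]addrC => /(rim_sign_uniq jk'_good)[ss2 t1t].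
split; split.
- exact: iso_rim_straight.
- by rewrite E1 t1t.
- by rewrite E2 -ss2.
- exact: iso_across_straight.
Qed.

Lemma sheared_shift s t : sheared s t (false, 0) -> forall x y : nat,
  let v0 := f (false, 0) in
  sheared s t (false, j *+ x + k *+ y) /\ f (false, j *+ x + k *+ y) =
    (v0.1, v0.2 + stp j' k' v0.1 *~ sg s *+ x + stp j' k' (~~ v0.1) *~ sg t *+ y).
Proof.
move=> sh0 x y v0.
have step v : sheared s t v -> [/\ sheared s t (rim j k v false),
     f (rim j k v false) = rim j' k' (f v) s, sheared s t (across j k v false) &
     f (across j k v false) = across j' k' (f v) t].
  by move=> sh; have [? ?] := sheared_square sh; case: sh.
elim: y => [|y [IHs IHf]].
  elim: x => [|x [IHs IHf]].
    by rewrite !mulr0n !addr0; split=> //; rewrite -surjective_pairing.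
  have [sA fA _ _] := step _ IHs.
  have -> : (false, j *+ x.+1 + k *+ 0) = rim j k (false, j *+ x + k *+ 0) false.
    by rewrite /rim /= mulr_sg !mulr0n !addr0 mulrSr.
  split=> //; rewrite fA IHf /rim /= !mulr0n !addr0; congr pair.
  by rewrite mulrSr addrA.
have [_ _ sA fA] := step _ IHs.
have -> : (false, j *+ x + k *+ y.+1) = across j k (false, j *+ x + k *+ y) false.
  by rewrite /across /= mulr_sg mulrSr addrA.
split=> //; rewrite fA IHf /across /=; congr pair.
by rewrite mulrSr addrA.
Qed.

Lemma iso_lat_sub : exists h, lat j k =2 lat (act h (j', k')).1 (act h (j', k')).2.
Proof.
have [s Es] := iso_rim (false, 0) false; have [t Et] := iso_across (false, 0) false.
have sh := sheared_shift (conj Es Et).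
set v0 := f (false, 0) in sh.
pose al := stp j' k' v0.1 *~ sg s; pose be := stp j' k' (~~ v0.1) *~ sg t.
have E : lat j k =2 lat al be.
  (* [sheared_shift] covers natural multiples only, so a relation is read as the coincidence of two
     such points, which the injective [f] preserves and reflects. *)
  move=> x y; have [x1 [x2 ->]] : exists x1 x2 : nat, x = x1%:Z - x2%:Z.
    by case: (intP x) => [|n|n]; [exists 0%N, 0%N | exists n.+1, 0%N | exists 0%N, n.+1];
       rewrite ?subr0 ?sub0r.
  have [y1 [y2 ->]] : exists y1 y2 : nat, y = y1%:Z - y2%:Z.
    by case: (intP y) => [|n|n]; [exists 0%N, 0%N | exists n.+1, 0%N | exists 0%N, n.+1];
       rewrite ?subr0 ?sub0r.
  rewrite /lat !mulrzBr (addrACA (j *~ _)) (addrACA (al *~ _)) -!opprD !subr_eq0 -!pmulrn.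
  have <- : (f (false, j *+ x1 + k *+ y1) == f (false, j *+ x2 + k *+ y2)) =
    (al *+ x1 + be *+ y1 == al *+ x2 + be *+ y2).
    by rewrite !(sh _ _).2 xpair_eqE eqxx /= -!addrA (inj_eq (addrI _)).
  by rewrite (inj_eq fI) xpair_eqE eqxx.
(* Only the relative sign matters up to negation, and the side of [v0] tells whether the rims are
   exchanged. *)
exists (s != t, v0.1) => x y; rewrite E /lat /al /be /act.
case: v0.1 s t {E sh Es Et al be} => [] [] [] /=; rewrite !mulr_sg ?mulNrz //.
all: by rewrite -[LHS]oppr_eq0 opprD ?opprK.
Qed.
End Iso.

Lemma iso_lat (V : finZmodType) (j k j' k' : V) :
  Lgood (lat j k) -> Lgood (lat j' k') ->
  graph_iso (Vgraph j k) (Vgraph j' k') ->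
  exists h, lat j k =2 lat (act h (j', k')).1 (act h (j', k')).2.
Proof. by move=> G G' [f [[g fK gK] fP]]; exact: iso_lat_sub fK gK fP. Qed.

(** * Relation lattices *)

(** Take for [s] the product of the primes dividing [a] but not [b]: each prime divisor of [a] then
    divides exactly one of [b] and [c * s]. *)
Lemma coprime_translate (a b c : nat) : (0 < a)%N ->
  gcdn a (gcdn b c) = 1%N -> exists s : nat, coprime (b + c * s) a.
Proof.
move=> a0 g1; pose s := (\prod_(p <- primes a | ~~ (p %| b)%N) p)%N; exists s.
have prod_dvd p : prime p -> (p %| a)%N -> (p %| s)%N = ~~ (p %| b)%N.
  move=> pp pa; rewrite /s Euclid_dvd_prod // big_has_cond.
  apply/hasP/idP => [[q]|pb].
    rewrite mem_primes => /and3P[pq _ qa] /andP[qb].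
    by rewrite dvdn_prime2 // => /eqP->.
  by exists p; rewrite ?mem_primes ?pp ?a0 ?pa //= pb dvdnn.
rewrite /coprime; apply/eqP; set d := gcdn _ _.
case: (ltngtP d 1) => // [|d1].
  by rewrite ltnS leqNgt gcdn_gt0 a0 orbT.
have [p pp pd] : exists2 p, prime p & (p %| d)%N by exists (pdiv d); rewrite ?pdiv_prime ?pdiv_dvd.
have pa : (p %| a)%N := dvdn_trans pd (dvdn_gcdr _ _).
have ps := dvdn_trans pd (dvdn_gcdl _ _).
have := prod_dvd p pp pa; case pb : (p %| b)%N => /= psE.
  move: ps; rewrite dvdn_addr // Euclid_dvdM // psE orbF => pc.
  have : (p %| 1)%N by rewrite -g1 !dvdn_gcd pa pb pc.
  by rewrite Euclid_dvd1.
by move: ps; rewrite dvdn_addl ?pb // dvdn_mull.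
Qed.

Definition rlat (n : nat) (j k x y : int) : bool := (n%:Z %| x * j + y * k)%Z.

Definition hlat (a b c : nat) (x y : int) : bool :=
  (a%:Z %| x)%Z && (c%:Z %| (x %/ a)%Z * b%:Z - y)%Z.

Lemma hlat_mul a b c t y : (0 < a)%N -> hlat a b c (t * a%:Z) y = (c%:Z %| t * b%:Z - y)%Z.
Proof. by move=> a0; rewrite /hlat dvdz_mull ?dvdzz // mulzK //; lia. Qed.

Lemma hlat0 a b c y : hlat a b c 0 y = (c%:Z %| y)%Z.
Proof. by rewrite /hlat dvdz0 div0z mul0r sub0r rpredN. Qed.

(** Uniqueness of the Hermite form: [c] generates the vertical vectors, [a] the first projection,
    and [b] is a residue modulo [c]. *)
Lemma hlat_inj a b c a' b' c' : (0 < a)%N -> (0 < a')%N -> (b < c)%N -> (b' < c')%N ->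
  hlat a b c =2 hlat a' b' c' -> [/\ a = a', b = b' & c = c'].
Proof.
move=> a0 a0' bc bc' E.
have cc d e f d' e' f' : (0 < d)%N -> (0 < d')%N -> hlat d e f =2 hlat d' e' f' ->
    (f' %| f)%N /\ (d' %| d)%N.
  move=> d0 d0' Ed; split.
    by have := Ed 0 f%:Z; rewrite !hlat0 dvdzz => /esym.
  have := Ed (1 * d%:Z) e%:Z; rewrite hlat_mul // !mul1r subrr dvdz0 /hlat.
  by move/esym/andP=> [].
have [cc1 aa1] := cc _ _ _ _ _ _ a0 a0' E.
have [cc2 aa2] := cc _ _ _ _ _ _ a0' a0 (fun x y => esym (E x y)).
have ca : a = a' by apply/eqP; rewrite eqn_dvd aa2 aa1.
have ce : c = c' by apply/eqP; rewrite eqn_dvd cc2 cc1.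
subst a' c'; split=> //.
have := E (1 * a%:Z) b%:Z; rewrite !hlat_mul // !mul1r subrr dvdz0 => /esym.
rewrite -eqz_mod_dvd => /eqP; rewrite !modz_nat !modn_small // => -[] //.
Qed.

Lemma rlat_hlat (m a c : nat) (j k : int) x y : (0 < m)%N -> (0 < a)%N -> (0 < c)%N ->
  coprimez a j ->
  rlat (m * a * c) (m%:Z * j) (m%:Z * a%:Z * k) x y =
  (a%:Z %| x)%Z && (c%:Z %| (x %/ a)%Z * j + y * k)%Z.
Proof.
move=> m0 a0 c0 aj; rewrite /rlat.
have -> : x * (m%:Z * j) + y * (m%:Z * a%:Z * k) = m%:Z * (x * j + y * (a%:Z * k)) by ring.
rewrite -mulnA PoszM dvdz_mul2l; last by lia.
case ax : (a%:Z %| x)%Z => /=; last first.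
  apply/negbTE/negP => /(dvdz_trans (_ : (a%:Z %| (a * c)%:Z)%Z)) H.
  have : (a%:Z %| x * j + y * (a%:Z * k))%Z by apply: H; rewrite PoszM dvdz_mulr.
  rewrite rpredDr; last by rewrite mulrCA dvdz_mulr.
  by rewrite Gauss_dvdzl // ax.
case/dvdzP: ax => t ->; rewrite mulzK; last by lia.
have -> : t * a%:Z * j + y * (a%:Z * k) = a%:Z * (t * j + y * k) by ring.
by rewrite PoszM dvdz_mul2l //; lia.
Qed.

(** Here m = gcd(n,j,k), m a = gcd(n,k), and c is the order of k in Z/n. *)
Lemma rlat_hnf (n : nat) (j k : int) : (0 < n)%N ->
  exists m a b c : nat,
    [/\ [/\ 0 < m, 0 < a & b < c]%N, (m * a * c)%N = n, gcdn a (gcdn b c) = 1%N &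
        rlat n j k =2 hlat a b c].
Proof.
move=> n0; pose g := gcdn n `|k|; have g0 : (0 < g)%N by rewrite gcdn_gt0 n0.
pose m := gcdn g `|j|; have m0 : (0 < m)%N by rewrite gcdn_gt0 g0.
pose a := (g %/ m)%N; pose c := (n %/ g)%N.
have gE : g = (m * a)%N by rewrite mulnC divnK ?dvdn_gcdl.
have nE : n = (m * a * c)%N by rewrite -gE mulnC divnK ?dvdn_gcdl.
have a0 : (0 < a)%N by move: g0; rewrite gE; lia.
have c0 : (0 < c)%N by move: n0; rewrite nE; lia.
have [k' kE] : exists k', k = k' * g%:Z by apply/dvdzP; rewrite dvdzE absz_nat dvdn_gcdr.
have [j' jE] : exists j', j = j' * m%:Z by apply/dvdzP; rewrite dvdzE absz_nat dvdn_gcdr.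
have cj : coprimez a j'.
  rewrite coprimezE absz_nat /coprime; rewrite -(eqn_pmul2l m0) muln1 muln_gcdr -gE.
  have -> : (m * `|j'|)%N = `|j|%N by rewrite jE abszM absz_nat mulnC.
  by rewrite eqxx.
have ck : coprimez c k'.
  rewrite coprimezE absz_nat /coprime; rewrite -(eqn_pmul2l g0) muln1 muln_gcdr.
  have -> : (g * `|k'|)%N = `|k|%N by rewrite kE abszM absz_nat mulnC.
  have -> : (g * c)%N = n by rewrite nE gE.
  by rewrite eqxx.
have [[u v] /= uv] : exists w : int * int, w.1 * c + w.2 * k' = 1.
  by have [u [v E]] := Bezoutz c k'; exists (u, v); rewrite E; apply/eqP.
(* As [v] inverts [k'] modulo [c], this [b] solves j' + b k' = 0 modulo c, which puts (a, b) into
   the lattice. *)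
pose bz := ((- (j' * v)) %% c)%Z; pose b := `|bz|%N.
have bzE : b%:Z = bz by rewrite gez0_abs // modz_ge0 //; lia.
have bc : (b < c)%N by rewrite -ltz_nat bzE; have := ltz_pmod (- (j' * v)) (d := c); lia.
have cb : (c%:Z %| b%:Z + j' * v)%Z.
  by rewrite bzE -[j' * v]opprK -eqz_mod_dvd modz_mod.
exists m, a, b, c; split=> //.
  have [r rE] : exists r, b%:Z = r * c%:Z - j' * v.
    by case/dvdzP: cb => r rE; exists r; rewrite -rE addrK.
  set d := gcdn _ _; have da : (d%:Z %| a%:Z)%Z by rewrite dvdzE !absz_nat dvdn_gcdl.
  have dc : (d%:Z %| c%:Z)%Z.
    by rewrite dvdzE !absz_nat (dvdn_trans (dvdn_gcdr _ _)) ?dvdn_gcdr.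
  have db : (d%:Z %| b%:Z)%Z.
    by rewrite dvdzE !absz_nat (dvdn_trans (dvdn_gcdr _ _)) ?dvdn_gcdl.
  have dj : (d%:Z %| j')%Z.
    have -> : j' = j' * u * c%:Z + k' * (r * c%:Z - b%:Z) by rewrite rE -[LHS]mulr1 -uv; ring.
    by rewrite rpredD ?dvdz_mull // rpredB ?dvdz_mull.
  have : (d%:Z %| gcdz a j')%Z by rewrite dvdz_gcd da dj.
  rewrite (eqP cj).
  by rewrite dvdz1 absz_nat => /eqP.
move=> x y.
have -> : rlat n j k x y = rlat (m * a * c) (m%:Z * j') (m%:Z * a%:Z * k') x y.
  by rewrite nE jE kE gE PoszM [j' * _]mulrC [k' * _]mulrC.
rewrite rlat_hlat // /hlat; congr andb; set t := (x %/ a)%Z.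
case/dvdzP: cb => r rE.
have E1 : t * j' + y * k' = c%:Z * (t * j' * u + t * k' * r) - k' * (t * b%:Z - y).
  have -> : b%:Z = r * c%:Z - j' * v by rewrite -rE addrK.
  by rewrite -[in LHS](mulr1 j') -uv; ring.
have E2 : t * b%:Z - y = c%:Z * (t * r - y * u) - v * (t * j' + y * k').
  have -> : b%:Z = r * c%:Z - j' * v by rewrite -rE addrK.
  by rewrite -[y in LHS]mulr1 -uv; ring.
apply/idP/idP => H; first by rewrite E2; apply: rpredB; [exact: dvdz_mulr | exact: dvdz_mull].
by rewrite E1; apply: rpredB; [exact: dvdz_mulr | exact: dvdz_mull].
Qed.

(** Moving [b] by a multiple of [c] keeps the lattice and makes [b] coprime to [a], as [rlat_hlat]
    requires. *)
Lemma hnf_realized (m a b c : nat) : (0 < m)%N -> (0 < a)%N -> (0 < c)%N ->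
  gcdn a (gcdn b c) = 1%N ->
  exists j k, rlat (m * a * c) j k =2 hlat a b c.
Proof.
move=> m0 a0 c0 g1; have [s cs] := coprime_translate a0 g1.
exists (m%:Z * - (b + c * s)%:Z), (m%:Z * a%:Z * 1) => x y.
rewrite rlat_hlat //; last by rewrite coprimezN coprimezE !absz_nat coprime_sym.
rewrite /hlat; congr andb; set t := (x %/ a)%Z.
rewrite -rpredN PoszD PoszM.
have -> : - (t * - (b%:Z + c%:Z * s%:Z) + y * 1) = c%:Z * (t * s%:Z) + (t * b%:Z - y) by ring.
by rewrite rpredDl ?dvdz_mulr.
Qed.

(** By inclusion of lattices, j -> j', k -> k' extends to the cyclic group that j and k generate in
    Z/n. Its generator m = gcd(j,k,n) goes to a multiple [v * m], since n/m kills the image. *)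
Lemma rlat_multiplier (n : nat) (j k j' k' : int) : (0 < n)%N ->
  (forall x y, rlat n j k x y -> rlat n j' k' x y) ->
  exists v, (n%:Z %| j' - v * j)%Z /\ (n%:Z %| k' - v * k)%Z.
Proof.
move=> n0 H; pose m := gcdz (gcdz j k) n.
have [[x y] [z E]] : exists xy : int * int, exists z : int, xy.1 * j + xy.2 * k + z * n%:Z = m.
  have [u [v E]] := Bezoutz j k; have [s [t E']] := Bezoutz (gcdz j k) n.
  by exists (s * u, s * v), t; rewrite /m -E' -E /=; ring.
rewrite /= in E.
have m0 : m != 0 by rewrite gcdz_eq0 negb_and; lia.
have [j0 jE] : exists j0, j = j0 * m.
  by apply/dvdzP; apply: dvdz_trans (dvdz_gcdl _ _); exact: dvdz_gcdl.
have [k0 kE] : exists k0, k = k0 * m.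
  by apply/dvdzP; apply: dvdz_trans (dvdz_gcdr _ _); exact: dvdz_gcdl.
have [n1 nE] : exists n1, n%:Z = n1 * m by apply/dvdzP; exact: dvdz_gcdr.
have n10 : n1 != 0 by apply/eqP => n10; move: nE; rewrite n10 mul0r; lia.
have [v vE] : exists v, x * j' + y * k' = v * m.
  apply/dvdzP; rewrite -(dvdz_mul2l n10) -nE.
  have : rlat n j' k' (n1 * x) (n1 * y).
    apply: H; apply/dvdzP; exists (1 - n1 * z).
    have -> : n1 * x * j + n1 * y * k = n1 * (m - z * n%:Z) by rewrite -E; ring.
    by rewrite nE; ring.
  by rewrite /rlat -!mulrA -mulrDr.
have E1 : x * j + y * k = m - z * n%:Z by rewrite -E; ring.
exists v; split.
  have -> : j' - v * j = (1 - j0 * x) * j' + - (j0 * y) * k'.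
    have -> : v * j = j0 * (x * j' + y * k') by rewrite vE jE; ring.
    by ring.
  apply: H; apply/dvdzP; exists (j0 * z).
  have -> : (1 - j0 * x) * j + - (j0 * y) * k = j - j0 * (x * j + y * k) by ring.
  by rewrite E1 {1}jE; ring.
have -> : k' - v * k = - (k0 * x) * j' + (1 - k0 * y) * k'.
  have -> : v * k = k0 * (x * j' + y * k') by rewrite vE kE; ring.
  by ring.
apply: H; apply/dvdzP; exists (k0 * z).
have -> : - (k0 * x) * j + (1 - k0 * y) * k = k - k0 * (x * j + y * k) by ring.
by rewrite E1 {1}kE; ring.
Qed.

(** The multipliers in the two directions are inverse only modulo n/m. Adding a multiple of n/m does
    not change the products with j and k, and [coprime_translate] finds one that yields a unit
    modulo n. *)
Lemma rlat_unit (n : nat) (j k j' k' : int) : (0 < n)%N ->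
  rlat n j k =2 rlat n j' k' ->
  exists u u' : int, [/\ (n%:Z %| j' - u * j)%Z, (n%:Z %| k' - u * k)%Z &
                         (n%:Z %| u * u' - 1)%Z].
Proof.
move=> n0 H.
have [v [vj vk]] : exists v, (n%:Z %| j' - v * j)%Z /\ (n%:Z %| k' - v * k)%Z.
  by apply: rlat_multiplier => // x y; rewrite H.
have [v' [vj' vk']] : exists v, (n%:Z %| j - v * j')%Z /\ (n%:Z %| k - v * k')%Z.
  by apply: rlat_multiplier => // x y; rewrite H.
pose m := gcdn (gcdn `|j| `|k|) n; have m0 : (0 < m)%N by rewrite gcdn_gt0 n0 orbT.
have [n1 nE] : exists n1, n = (n1 * m)%N by apply/dvdnP; exact: dvdn_gcdr.
have mj : (m%:Z %| j)%Z.
  by rewrite dvdzE absz_nat (dvdn_trans (dvdn_gcdl _ _)) // dvdn_gcdl.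
have mk : (m%:Z %| k)%Z.
  by rewrite dvdzE absz_nat (dvdn_trans (dvdn_gcdl _ _)) // dvdn_gcdr.
have vv1 : (n1%:Z %| 1 - v * v')%Z.
  have mE : m%:Z = gcdz (gcdz j k) n by [].
  have [x [y xy]] := Bezoutz j k; have [s [t st]] := Bezoutz (gcdz j k) n.
  rewrite -(@dvdz_mul2l m%:Z); last by lia.
  rewrite -PoszM mulnC -nE mE -st -xy.
  have -> : (s * (x * j + y * k) + t * n%:Z) * (1 - v * v') =
    s * x * (j - v' * j') + s * x * v' * (j' - v * j) +
    s * y * (k - v' * k') + s * y * v' * (k' - v * k) + t * (1 - v * v') * n%:Z by ring.
  by rewrite !rpredD // dvdz_mull.
pose w := `|(v %% n)%Z|%N; have wE : w%:Z = (v %% n)%Z.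
  by rewrite gez0_abs // modz_ge0 //; lia.
have nw : (n%:Z %| v - w%:Z)%Z by rewrite -eqz_mod_dvd wE modz_mod.
have g1 : gcdn n (gcdn w n1) = 1%N.
  set d := gcdn _ _; have dn : (d%:Z %| n%:Z)%Z by rewrite dvdzE !absz_nat dvdn_gcdl.
  have dw : (d%:Z %| w%:Z)%Z.
    by rewrite dvdzE !absz_nat (dvdn_trans (dvdn_gcdr _ _)) ?dvdn_gcdl.
  have dn1 : (d%:Z %| n1%:Z)%Z.
    by rewrite dvdzE !absz_nat (dvdn_trans (dvdn_gcdr _ _)) ?dvdn_gcdr.
  have dv : (d%:Z %| v)%Z by rewrite -[v](subrK w%:Z) rpredD // (dvdz_trans dn).
  have : (d%:Z %| 1 - v * v' + v * v')%Z.
    by apply: rpredD; [apply: dvdz_trans dn1 _ | apply: dvdz_mulr].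
  by rewrite subrK dvdz1 absz_nat => /eqP.
have [s cs] := coprime_translate n0 g1.
have [u' [t E]] : exists u' t : int, (w + n1 * s)%:Z * u' + t * n%:Z = 1.
  have [x [y E]] := Bezoutz (w + n1 * s)%N n; exists x, y; rewrite mulrC E.
  by rewrite /gcdz !absz_nat; congr Posz; apply/eqP.
have nn1 z : (m%:Z %| z)%Z -> (n%:Z %| n1%:Z * s%:Z * z)%Z.
  by case/dvdzP=> q ->; apply/dvdzP; exists (s%:Z * q); rewrite nE PoszM; ring.
exists (w + n1 * s)%:Z, u'; split.
- have -> : j' - (w + n1 * s)%:Z * j = (j' - v * j) + j * (v - w%:Z) - n1%:Z * s%:Z * j.
    by rewrite PoszD PoszM; ring.
  by rewrite rpredB ?nn1 // rpredD // dvdz_mull.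
- have -> : k' - (w + n1 * s)%:Z * k = (k' - v * k) + k * (v - w%:Z) - n1%:Z * s%:Z * k.
    by rewrite PoszD PoszM; ring.
  by rewrite rpredB ?nn1 // rpredD // dvdz_mull.
- by rewrite -E opprD addNKr rpredN dvdz_mull.
Qed.

(** * Isomorphisms induced by signs, the swap and units *)

Section Vgraph_iso.
Variable V : finZmodType.
Implicit Types j k : V.

Lemma Vgraph_oppl j k : graph_iso (Vgraph j k) (Vgraph (- j) k).
Proof.
exists id; split; first by exists id.
move=> [l x] [l' y] /=; rewrite /Vadj /=; case: eqP => // _; case: l => //=.
have E (a b : V) : (a == b - j) = (b == a + j) by rewrite eq_sym subr_eq.
by rewrite !E orbC.
Qed.

Lemma Vgraph_swap j k : graph_iso (Vgraph j k) (Vgraph k j).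
Proof.
exists (@spoke V); split; first by exists (@spoke V); exact: spokeK.
by move=> [l x] [l' y] /=; rewrite /Vadj /= (inj_eq negb_inj); case: l.
Qed.

Lemma Vgraph_act g j k :
  graph_iso (Vgraph j k) (Vgraph (act g (j, k)).1 (act g (j, k)).2).
Proof.
have H s : graph_iso (Vgraph j k) (Vgraph (j *~ sg s) k).
  by case: s; rewrite mulr_sg; [exact: Vgraph_oppl | exact: graph_iso_refl].
case: g => s [] /=; last exact: H.
exact: graph_iso_trans (H s) (Vgraph_swap _ _).
Qed.

Lemma Vgraph_unit (u u' : int) j k : (forall x : V, x *~ (u * u') = x) ->
  graph_iso (Vgraph j k) (Vgraph (j *~ u) (k *~ u)).
Proof.
move=> uu; have uK : cancel (fun x : V => x *~ u) (fun x => x *~ u').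
  by move=> x; rewrite -mulrzA uu.
have uK' : cancel (fun x : V => x *~ u') (fun x => x *~ u).
  by move=> x; rewrite -mulrzA mulrC uu.
exists (fun v => (v.1, v.2 *~ u)); split.
  by exists (fun v => (v.1, v.2 *~ u')) => -[l x] /=; rewrite ?uK ?uK'.
move=> [l x] [l' y]; rewrite /= /Vadj /=.
have -> : stp (j *~ u) (k *~ u) l = stp j k l *~ u by case: l.
by rewrite -!mulrzDl !(can_eq uK).
Qed.
End Vgraph_iso.

Section Zn.
Variable n : nat.
Definition zi (z : int) : 'I_n.+1 := (inZp 1 : 'I_n.+1) *~ z.

Lemma zi_nat (j : nat) : zi j%:Z = inZp j.
Proof. by rewrite /zi -pmulrn Zp_mulrn; apply: val_inj; rewrite /= modnMml mul1n. Qed.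

Lemma zi_ord (i : 'I_n.+1) : zi i%:Z = i.
Proof. by rewrite zi_nat valZpK. Qed.

Lemma zi_eq0 z : (zi z == 0) = (n.+1%:Z %| z)%Z.
Proof.
case: (intP z) => [|m|m]; first by rewrite /zi mulr0z eqxx dvdz0.
  by rewrite zi_nat -val_eqE /= dvdzE.
by rewrite /zi mulrNz oppr_eq0 -/(zi m.+1) zi_nat -val_eqE /= rpredN dvdzE.
Qed.

Lemma zi_eq x y : (zi x == zi y) = (n.+1%:Z %| x - y)%Z.
Proof. by rewrite -subr_eq0 -mulrzBr zi_eq0. Qed.

Lemma lat_zi j k x y : lat (zi j) (zi k) x y = rlat n.+1 j k x y.
Proof. by rewrite /lat -!mulrzA -mulrzDr zi_eq0 /rlat [x * j]mulrC [y * k]mulrC. Qed.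

Definition Zgraph (j k : int) := Vgraph (zi j) (zi k).

Lemma Igraph_Zgraph (j k : nat) : graph_iso (Igraph n.+1 j k) (Zgraph j k).
Proof.
pose f (u : 'I_n.+1 + 'I_n.+1) := match u with inl i => (false, i) | inr i => (true, i) end.
pose g (v : bool * 'I_n.+1) : 'I_n.+1 + 'I_n.+1 := if v.1 then inr v.2 else inl v.2.
exists f; split; first by exists g; [case | case=> -[] i].
have E (i i' : 'I_n.+1) m : (i' == i + zi m%:Z) = (i + m == i' %[mod n.+1])%N.
  by rewrite zi_nat -val_eqE /= modnDmr [(i' %% _)%N]modn_small // eq_sym.
by case=> i [] i' //=; rewrite /Vadj /= !E.
Qed.

Lemma rlat_iso j k j' k' : rlat n.+1 j k =2 rlat n.+1 j' k' ->
  graph_iso (Zgraph j k) (Zgraph j' k').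
Proof.
case/(rlat_unit (ltn0Sn n)) => u [u' [uj uk uu]].
have := @Vgraph_unit _ u u' (zi j) (zi k); rewrite /Zgraph.
have -> : zi j *~ u = zi j'.
  by apply/eqP; rewrite eq_sym -mulrzA zi_eq mulrC.
have -> : zi k *~ u = zi k'.
  by apply/eqP; rewrite eq_sym -mulrzA zi_eq mulrC.
apply=> x; rewrite -[x]zi_ord -mulrzA; apply/eqP; rewrite zi_eq.
by rewrite -[X in _ - X]mulr1 -mulrBr dvdz_mull.
Qed.

End Zn.

Definition tlat N (t : tok N) : int -> int -> bool := hlat t.1.2 t.2.2 t.2.1.

(** * Exceptional lattices *)

Lemma card_fibre_le N K (E : {set tok N}) (B : 'I_N.+1 * 'I_N.+1 -> 'I_N.+1 -> {set 'I_N.+1}) :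
  E \subset hnfs N ->
  (forall t, t \in E -> t.2.2 \in B t.1 t.2.1) ->
  (forall (p : 'I_N.+1 * 'I_N.+1) (c : 'I_N.+1), (0 < p.2)%N -> (0 < c)%N ->
    (#|B p c| <= K)%N) ->
  (#|E| <= K * #|facs N|)%N.
Proof.
move=> /fintype.subsetP EX EB BK.
apply: (card_le_cover (F := fun i => [set (i.1, (i.2, b)) | b in B i.1 i.2])).
  move=> t tE; exists (t.1, t.2.1).
    have := EX t tE; rewrite !inE /= => /and5P[-> -> bc -> _] /=.
    by rewrite andbT (leq_ltn_trans _ bc).
  by apply/imsetP; exists t.2.2; rewrite ?EB //; case: t {tE} => [p [c b]].
move=> i; rewrite inE => /and4P[_ a0 c0 _].
exact: leq_trans (leq_imset_card _ _) (BK _ _ a0 c0).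
Qed.

Definition bads N : {set tok N} := [set t in hnfs N | ~~ `[< Lgood (tlat t) >]].

(** If [x = 0], then [c] divides [y] and is at most 8. If [x = t * a], the products [t * b] are
    congruent modulo [c], leaving at most [|t|] values of [b]. *)
Lemma card_hlat_le N (a c : 'I_N.+1) (x y : int) : (0 < a)%N -> (0 < c)%N ->
  `|x| <= 8 -> `|y| <= 8 -> (x != 0) || (y != 0) ->
  (#|[set b : 'I_N.+1 | (b < c)%N && hlat a b c x y]| <= 8)%N.
Proof.
move=> a0 c0 x8 y8; case: (eqVneq x 0) => [-> /= y0|x0 _].
  case: (boolP (c%:Z %| y)%Z) => cy; last first.
    rewrite (_ : [set b | _] = finset.set0) ?cards0 //.
    by apply/setP => b; rewrite !inE hlat0 (negbTE cy) andbF.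
  have c8 : (c <= 8)%N.
    case/dvdzP: cy => q yE.
    have : q != 0 by apply/eqP => q0; move: y0; rewrite yE q0 mul0r eqxx.
    by move: y8; rewrite yE normrM; nia.
  apply: leq_trans c8; apply: (card_dvd_le (c := c)) => // [b|b b' _ _].
    by rewrite inE => /andP[].
  by rewrite -mulrBr dvdz_mulr.
case: (boolP (a%:Z %| x)%Z) => ax; last first.
  rewrite (_ : [set b | _] = finset.set0) ?cards0 //.
  by apply/setP => b; rewrite !inE /hlat (negbTE ax) andbF.
case/dvdzP: ax => t xE; have t0 : t != 0 by apply/eqP => t0; rewrite t0 mul0r in xE; rewrite xE in x0.
have t8 : (`|t| <= 8)%N by move: x8; rewrite xE normrM; nia.
apply: leq_trans t8; apply: (card_dvd_le (c := c)); first by rewrite absz_gt0.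
  by move=> b; rewrite inE => /andP[].
move=> b b'; rewrite !inE xE !hlat_mul // => /andP[_ H] /andP[_ H'].
have E : (c%:Z %| t * b%:Z - t * b'%:Z)%Z.
  by have := rpredB H H'; rewrite opprB addrA subrK.
by rewrite abszE; case: (ltrP t 0) => ts; rewrite ?(ltr0_norm ts) ?(ger0_norm ts) //
  !mulNr opprK -rpredN opprD opprK.
Qed.

(** 2312 = 17^2 * 8: at most 8 forms per triple for each of the vectors in the box. *)
Lemma card_bads N : (#|bads N| <= 2312 * #|facs N|)%N.
Proof.
pose v (p : 'I_17 * 'I_17) : int * int := (p.1%:Z - 8, p.2%:Z - 8).
pose nz p := ((v p).1 != 0) || ((v p).2 != 0).
pose E p := [set t in hnfs N | nz p && tlat t (v p).1 (v p).2].
have cov : (#|bads N| <= 8 * #|facs N| * #|[set: 'I_17 * 'I_17]|)%N.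
  apply: (card_le_cover (F := E)) => [t|p _].
    rewrite inE => /andP[tX /asboolPn/existsNP[x /existsNP[y]]].
    move=> /not_implyP[x8 /not_implyP[y8 /not_implyP[Lxy xy0]]].
    have bd z : `|z| <= 8 -> exists i : 'I_17, i%:Z - 8 = z :> int.
      move=> z8; have zl : (`|(z + 8)%R| < 17)%N by lia.
      by exists (Ordinal zl); rewrite /=; lia.
    have [i iE] := bd x x8; have [j jE] := bd y y8.
    exists (i, j) => //; rewrite inE tX /nz /= iE jE Lxy andbT.
    by rewrite -negb_and; apply/negP => /andP[/eqP x0 /eqP y0]; apply: xy0.
  case: (boolP (nz p)) => np; last first.
    rewrite (_ : E p = finset.set0) ?cards0 //.
    by apply/setP => t; rewrite !inE (negbTE np) andbF.
  apply: (@card_fibre_le _ _ _ (fun q c => [set b : 'I_N.+1 | (b < c)%N && hlat q.2 b c (v p).1 (v p).2])).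
  - by apply/fintype.subsetP => t; rewrite inE => /andP[].
  - by move=> t; rewrite !inE => /andP[/and5P[_ _ bc _ _]] /andP[_ H]; apply/andP.
  - move=> q c q0 c0; apply: card_hlat_le => //.
      by case: p {np} => [[i Hi] j]; rewrite /v /=; lia.
    by case: p {np} => [i [j Hj]]; rewrite /v /=; lia.
move: cov; rewrite cardsT card_prod !card_ord; lia.
Qed.

(** Invariance under one of the three nontrivial symmetries: sign change, swap, quarter turn. *)
Definition Lfix (L : int -> int -> bool) : Prop :=
  [\/ forall x y, L (- x) y = L x y, forall x y, L y x = L x y
    | forall x y, L (- y) x = L x y].

Definition fixs N : {set tok N} := [set t in hnfs N | `[< Lfix (tlat t) >]].

Lemma card_half_le N :
  (#|[set t in hnfs N | (t.2.1%:Z %| (2 * t.2.2%:Z)%R)%Z]| <= 2 * #|facs N|)%N.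
Proof.
apply: (@card_fibre_le _ _ _ (fun _ c => [set b : 'I_N.+1 | (b < c)%N && (c%:Z %| 2 * b%:Z)%Z])).
- by apply/fintype.subsetP => t; rewrite inE => /andP[].
- by move=> t; rewrite !inE => /andP[/and5P[_ _ bc _ _]] H; apply/andP.
move=> p c _ c0; apply: (card_dvd_le (c := c)) => // [b|b b'].
  by rewrite inE => /andP[].
by rewrite !inE => /andP[_ H] /andP[_ H']; exact: rpredB.
Qed.

(* The square roots [b] of [+-1] modulo [c] are recovered, up to two choices,
   from the divisor [d = gcd (c, b - b0)], where [b0] is a fixed root. *)
Lemma sqrt_sign_diff (s : bool) (d e : nat) (b0 b b' : int) :
  (d%:Z %| b - b0)%Z -> (e%:Z %| b + b0)%Z ->
  (d%:Z %| b' - b0)%Z -> (e%:Z %| b' + b0)%Z ->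
  ((d * e)%:Z %| b * b - sg s)%Z -> ((d * e)%:Z %| 2 * b - 2 * b')%Z.
Proof.
move=> db eb db' eb' cb; pose h := gcdz d e.
have hd : (h %| d%:Z)%Z by exact: dvdz_gcdl.
have he : (h %| e%:Z)%Z by exact: dvdz_gcdr.
have h2 : (h %| 2%:R)%Z.
  have h2b : (h %| 2 * b)%Z.
    have -> : 2 * b = (b - b0) + (b + b0) by ring.
    by apply: rpredD; [apply: dvdz_trans hd _ | apply: dvdz_trans he _].
  have hs : (h %| b * b - sg s)%Z.
    by apply: dvdz_trans cb; rewrite PoszM dvdz_mulr.
  have : (h %| b * (2 * b) - 2 * (b * b - sg s))%Z.
    by apply: rpredB; rewrite dvdz_mull.
  have -> : b * (2 * b) - 2 * (b * b - sg s) = 2 * sg s by ring.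
  by case: (s); rewrite /sg ?mulrN1 ?mulr1 ?rpredN.
have [u [v uv]] := Bezoutz d e; case/dvdzP: h2 => q qE.
have de : (e%:Z %| b - b')%Z.
  by have -> : b - b' = (b + b0) - (b' + b0) by [ring]; apply: rpredB.
have dd : (d%:Z %| b - b')%Z.
  by have -> : b - b' = (b - b0) - (b' - b0) by [ring]; apply: rpredB.
have -> : 2 * b - 2 * b' = q * u * (d%:Z * (b - b')) + q * v * (e%:Z * (b - b')).
  by rewrite -mulrBr qE /h -uv; ring.
apply: rpredD; apply: dvdz_mull; first by rewrite PoszM dvdz_mul.
by rewrite PoszM mulrC dvdz_mul.
Qed.

(** The number of square roots modulo [c] is unbounded, so the triple [(m, 1, c)] cannot index them.
    As [a = 1] leaves a slot free, the triple [(m, d, e)] with [d * e = c] is used instead. *)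
Lemma card_sqrt_le N s :
  (#|[set t in hnfs N | (t.1.2 == 1%N :> nat) &&
       (t.2.1%:Z %| (t.2.2%:Z * t.2.2%:Z - sg s)%R)%Z]|
    <= 2 * #|facs N|)%N.
Proof.
have [b0 b0P] : {b0 : nat -> int & forall c, forall b : nat,
    (c%:Z %| b%:Z * b%:Z - sg s)%Z -> (c%:Z %| b0 c * b0 c - sg s)%Z}.
  apply: (@choice _ _ (fun (c : nat) (b0 : int) => forall b : nat,
    (c%:Z %| b%:Z * b%:Z - sg s)%Z -> (c%:Z %| b0 * b0 - sg s)%Z)).
  move=> c.
  have [[b H]|nH] := pselect (exists b : nat, (c%:Z %| b%:Z * b%:Z - sg s)%Z).
    by exists b%:Z.
  by exists 0 => b H; case: nH; exists b.
pose B (d e : nat) := [set b : 'I_N.+1 | [&& (b < d * e)%N,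
  (d%:Z %| b%:Z - b0 (d * e)%N)%Z, (e%:Z %| b%:Z + b0 (d * e)%N)%Z &
  ((d * e)%:Z %| b%:Z * b%:Z - sg s)%Z]].
apply: (card_le_cover (F := fun i : ('I_N.+1 * 'I_N.+1) * 'I_N.+1 =>
  [set (((i.1.1, inord 1), (inord (i.1.2 * i.2)%N, b)) : tok N) | b in B i.1.2 i.2])).
  case=> -[m a] [c b]; rewrite !inE /= => /andP[/and5P[m0 _ bc macN _]] /andP[/eqP a1 cb].
  have cb0 := b0P _ _ cb; set r := b0 c in cb0.
  have c0 : (0 < c)%N by apply: leq_ltn_trans bc.
  pose d := gcdn c `|b%:Z - r|; pose e := (c %/ d)%N.
  have d0 : (0 < d)%N by rewrite gcdn_gt0 c0.
  have cE : (d * e = c)%N by rewrite mulnC divnK ?dvdn_gcdl.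
  have e0 : (0 < e)%N by move: c0; rewrite -cE muln_gt0 => /andP[].
  have cN := ltn_ord c.
  have dN : (d < N.+1)%N by apply: leq_ltn_trans cN; rewrite -cE leq_pmulr.
  have eN : (e < N.+1)%N by apply: leq_ltn_trans cN; rewrite -cE leq_pmull.
  exists ((m, inord d), inord e).
    rewrite inE /= !inordK // m0 d0 e0 /= -mulnA cE.
    by move: macN; rewrite a1 muln1.
  rewrite /= !inordK //; apply/imsetP; exists b; last first.
    congr ((_, _), (_, _)); apply: val_inj; rewrite /= inordK ?cE //.
    by rewrite ltnS; apply: leq_trans c0 _; rewrite -ltnS.
  rewrite inE cE bc cb andbT /= -/r.
  have dr : (d%:Z %| b%:Z - r)%Z by rewrite dvdzE absz_nat dvdn_gcdr.
  rewrite dr /=; case/dvdzP: dr => q qE.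
  have eq1 : coprimez e q.
    rewrite coprimezE absz_nat /coprime -(eqn_pmul2l d0) muln1 muln_gcdr cE.
    have -> : (d * `|q|)%N = `|b%:Z - r|%N by rewrite qE abszM absz_nat mulnC.
    by rewrite eqxx.
  have : (c%:Z %| (b%:Z - r) * (b%:Z + r))%Z.
    have -> : (b%:Z - r) * (b%:Z + r) = (b%:Z * b%:Z - sg s) - (r * r - sg s) by ring.
    exact: rpredB.
  rewrite qE -cE PoszM mulrAC [_ * d%:Z]mulrC dvdz_mul2l; last by lia.
  by rewrite Gauss_dvdzr.
move=> [[m d] e] _ /=; apply: leq_trans (leq_imset_card _ _) _.
apply: (card_dvd_le (c := (d * e)%N)) => // [b|b b'].
  by rewrite inE => /and4P[].
rewrite !inE => /and4P[_ db eb cb] /and4P[_ db' eb' _].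
exact: sqrt_sign_diff db eb db' eb' cb.
Qed.

(** The sign change applied to (a, b) gives c | 2b. The swap and the quarter turn applied to (0, c)
    give (c, 0), hence a divides b and c, so a = 1; applied to (1, b) they give b^2 = 1 or -1 modulo
    c. *)
Lemma card_fixs N : (#|fixs N| <= 6 * #|facs N|)%N.
Proof.
pose E (i : 'I_3) : {set tok N} := if i == 0%N :> nat then
   [set t in hnfs N | (t.2.1%:Z %| 2 * t.2.2%:Z)%Z] else
   [set t in hnfs N | (t.1.2 == 1%N :> nat) &&
      (t.2.1%:Z %| t.2.2%:Z * t.2.2%:Z - sg (i == 2%N :> nat))%Z].
have cov : (#|fixs N| <= 2 * #|facs N| * #|[set: 'I_3]|)%N.
  apply: (card_le_cover (F := E)) => [t|i _]; last first.
    by rewrite /E; case: ifP => _; [exact: card_half_le | exact: card_sqrt_le].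
  rewrite inE => /andP[tX /asboolP tfix].
  have := tX; rewrite inE => /and5P[_ a0 bc _ /eqP g1].
  move: tfix; rewrite /Lfix /tlat.
  set a := nat_of_ord t.1.2 in a0 g1 *; set b := nat_of_ord t.2.2 in bc g1 *.
  set c := nat_of_ord t.2.1 in bc g1 *.
  have c0 : (0 < c)%N by apply: leq_ltn_trans bc.
  have Lab : hlat a b c a%:Z b%:Z.
    by rewrite -[a%:Z]mul1r hlat_mul // mul1r subrr dvdz0.
  have Lc : hlat a b c 0 c%:Z by rewrite hlat0 dvdzz.
  have a_eq1 : hlat a b c c%:Z 0 -> a = 1%N.
    rewrite /hlat subr0 => /andP[/dvdzP[q cE]].
    rewrite cE mulzK; last by lia.
    rewrite dvdz_mul2l; last by apply/eqP => q0; move: cE; rewrite q0 mul0r; lia.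
    move=> ab; apply/eqP; rewrite -dvdn1 -g1 !dvdn_gcd dvdnn /=.
    move: ab; rewrite dvdzE !absz_nat => -> /=.
    by have : (a%:Z %| c%:Z)%Z by [rewrite cE dvdz_mull]; rewrite dvdzE !absz_nat.
  case=> H.
  - exists (inord 0) => //; rewrite /E inordK //= inE tX /= -/b -/c.
    have := Lab; rewrite -H -mulN1r hlat_mul // mulN1r => H1.
    by have <- : - (- b%:Z - b%:Z) = 2 * b%:Z by [ring]; rewrite rpredN.
  - have a1 : a = 1%N by apply: a_eq1; rewrite H.
    exists (inord 1) => //; rewrite /E inordK //= inE tX /= -/a -/b -/c a1 eqxx /=.
    have H1 : hlat a b c (b%:Z * a%:Z) 1%N%:Z by have := Lab; rewrite -H a1 mulr1.
    by rewrite hlat_mul // in H1.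
  - have a1 : a = 1%N.
      apply: a_eq1; have := H 0 (- c%:Z); rewrite opprK => ->.
      by rewrite hlat0 rpredN dvdzz.
    exists (inord 2) => //; rewrite /E inordK //= inE tX /= -/a -/b -/c a1 eqxx /=.
    have H1 : hlat a b c (- b%:Z * a%:Z) 1%N%:Z by have := Lab; rewrite -H a1 mulr1.
    rewrite hlat_mul // in H1.
    have <- : - (- b%:Z * b%:Z - 1) = b%:Z * b%:Z - sg true by rewrite /sg; ring.
    by rewrite rpredN.
move: cov; rewrite cardsT card_ord; lia.
Qed.

(** * Lattices and isomorphism classes *)

Definition alat (n : nat) (e : bool * bool) (j k : int) : int -> int -> bool :=
  rlat n (act e (j, k)).1 (act e (j, k)).2.

Lemma zi_act n e (j k : int) :
  act e (zi n j, zi n k) = (zi n (act e (j, k)).1, zi n (act e (j, k)).2).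
Proof. by case: e => -[] []; rewrite /act /= !mulr_sg // /zi mulrNz. Qed.

Lemma rlatN n j k : rlat n (- j) (- k) =2 rlat n j k.
Proof. by move=> x y; rewrite /rlat !mulrN -opprD rpredN. Qed.

Lemma alat_sg n s t (j k : int) :
  rlat n (j *~ sg s) (k *~ sg t) =2 alat n (s != t, false) j k.
Proof.
move=> x y; rewrite /alat /act /=; case: s t => [] []; rewrite !mulr_sg //.
- by rewrite rlatN.
- by rewrite -rlatN opprK.
Qed.

Lemma alat_swap n e (j k : int) : alat n (e, true) j k =2 alat n (e, false) k j.
Proof.
move=> x y; rewrite /alat /act /=; case: e; rewrite !mulr_sg //.
by rewrite -rlatN opprK.
Qed.

Lemma alat_closed n e h (j k : int) : exists h',
  rlat n (act e (act h (j, k))).1 (act e (act h (j, k))).2 =2 alat n h' j k.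
Proof.
exists (addb e.1 h.1, addb e.2 h.2) => x y; rewrite /alat /act.
case: e h => -[] [] [[] []] /=; rewrite !mulr_sg ?opprK //; by rewrite -rlatN !opprK.
Qed.

Lemma rlat_swap n j k x y : rlat n j k x y = rlat n k j y x.
Proof. by rewrite /rlat addrC. Qed.

Lemma rlat_oppl n j k x y : rlat n (- j) k x y = rlat n j k (- x) y.
Proof. by rewrite /rlat mulrN mulNr. Qed.

Lemma rlat_opp n j k x y : rlat n j k (- x) (- y) = rlat n j k x y.
Proof. by rewrite /rlat !mulNr -opprD rpredN. Qed.

Lemma alatE n e (j k x y : int) : alat n e j k x y =
  (if e.2 then rlat n j k (y *~ sg e.1) x else rlat n j k (x *~ sg e.1) y).
Proof.
by case: e => -[] []; rewrite /alat /act /= !mulr_sg ?rlat_oppl // rlat_swap ?rlat_oppl.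
Qed.

Lemma alat_inj n e e' (j k : int) : ~ Lfix (rlat n j k) ->
  alat n e j k =2 alat n e' j k -> e = e'.
Proof.
move=> nfix E; set L := rlat n j k in nfix.
have LN x y : L (- x) (- y) = L x y by exact: rlat_opp.
have {}E x y : (if e.2 then L (y *~ sg e.1) x else L (x *~ sg e.1) y) =
               (if e'.2 then L (y *~ sg e'.1) x else L (x *~ sg e'.1) y).
  by have := E x y; rewrite !alatE.
have r x y : L x (- y) = L (- x) y by rewrite -LN opprK.
case: e e' E => -[] [] [[] []] //= E; exfalso; apply: nfix.
all: try by constructor 1 => x y; have := E x y; rewrite !mulr_sg.
all: try by constructor 1 => x y; have := E y x; rewrite !mulr_sg.
all: try by constructor 2 => x y; have := E x y; rewrite !mulr_sg.
all: try by constructor 3 => x y; have := E x y; rewrite !mulr_sg.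
all: try by constructor 2 => x y; have := E (- x) y; rewrite !mulr_sg ?opprK -?r ?LN.
all: try by constructor 3 => x y; have := E (- x) y; rewrite !mulr_sg ?opprK -?r ?LN.
all: try by constructor 2 => x y; have := E x (- y); rewrite !mulr_sg ?opprK ?r ?LN.
all: try by constructor 3 => x y; have := E x (- y); rewrite !mulr_sg ?opprK ?r ?LN.
all: by constructor 2 => x y; have := E x (- y); rewrite !mulr_sg opprK LN.
Qed.

Lemma Igraph_iso_of_alat n j k j' k' e e' : (0 < n)%N ->
  alat n e j%:Z k%:Z =2 alat n e' j'%:Z k'%:Z ->
  graph_iso (Igraph n j k) (Igraph n j' k').
Proof.
case: n => // n _ /rlat_iso H.
apply: graph_iso_trans (Igraph_Zgraph n j k) _.
apply: graph_iso_trans (Vgraph_act e (zi n j) (zi n k)) _.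
apply: graph_iso_trans; last exact: graph_iso_sym (Igraph_Zgraph n j' k').
apply: graph_iso_trans; last exact: graph_iso_sym (Vgraph_act e' (zi n j') (zi n k')).
by rewrite !zi_act.
Qed.

Lemma alat_of_Igraph_iso n (j k j' k' : nat) : (0 < n)%N ->
  Lgood (rlat n j k) -> Lgood (rlat n j' k') ->
  graph_iso (Igraph n j k) (Igraph n j' k') ->
  exists h, rlat n j k =2 alat n h j' k'.
Proof.
case: n => // n _ G G' H.
have good i l : Lgood (rlat n.+1 i l) -> Lgood (lat (zi n i) (zi n l)).
  by move=> Gil x y x8 y8; rewrite lat_zi; exact: Gil.
have [|h hE] := iso_lat (good _ _ G) (good _ _ G').
  apply: graph_iso_trans (graph_iso_sym (Igraph_Zgraph n j k)) _.
  exact: graph_iso_trans H (Igraph_Zgraph n j' k').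
by exists h => x y; rewrite -lat_zi hE zi_act lat_zi.
Qed.

Lemma Igraph_iso_size n j k n' j' k' :
  graph_iso (Igraph n j k) (Igraph n' j' k') -> n = n'.
Proof.
case=> f [[g fK gK] _].
have cardI (m : nat) : #|{: 'I_m + 'I_m}| = (m + m)%N by rewrite card_sum !card_ord.
have := leq_card f (can_inj fK); have := leq_card g (can_inj gK).
rewrite /= !cardI; lia.
Qed.

Lemma rlat_congr n j k j' k' : (n%:Z %| j - j')%Z -> (n%:Z %| k - k')%Z ->
  rlat n j k =2 rlat n j' k'.
Proof.
move=> hj hk x y; rewrite /rlat.
have -> : x * j + y * k = (x * (j - j') + y * (k - k')) + (x * j' + y * k') by ring.
by rewrite rpredDl // rpredD ?dvdz_mull.
Qed.

Lemma small_residue (n : nat) (z : int) : (0 < n)%N -> ~~ (n%:Z %| z)%Z ->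
  exists (i : nat) (s : bool), [/\ (0 < i)%N, (2 * i <= n)%N & (n%:Z %| z - i%:Z *~ sg s)%Z].
Proof.
move=> n0 nz; pose r := (z %% n)%Z.
have r0 : 0 <= r by rewrite modz_ge0 //; lia.
have rn : r < n%:Z by rewrite ltz_pmod.
have rz : r != 0 by apply: contra nz => /eqP rz; apply/dvdz_mod0P.
have nr : (n%:Z %| z - r)%Z by rewrite -eqz_mod_dvd modz_mod.
case: (leqP (2 * `|r|) n) => h.
  exists `|r|%N, false; rewrite mulr_sg absz_gt0 rz; split=> //.
  by rewrite gez0_abs.
exists (n - `|r|)%N, true; rewrite mulr_sg opprK; split; [lia|lia|].
have -> : z + (n - `|r|)%:Z = (z - r) + n%:Z by lia.
by rewrite rpredD // dvdzz.
Qed.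

Lemma Lgood_eq L L' : L =2 L' -> Lgood L -> Lgood L'.
Proof. by move=> E G x y x8 y8; rewrite -E; exact: G. Qed.

(** Goodness excludes the relations (1,0), (0,1) and, for n <= 8, (n,0). So j and k are nonzero
    modulo n, and signs and the swap bring them into the admissible range. *)
Lemma good_params n (j k : int) : (0 < n)%N -> Lgood (rlat n j k) ->
  exists j1 k1 e, Iparam n j1 k1 /\ rlat n j k =2 alat n e j1 k1.
Proof.
move=> n0 G.
have n8 : (8 < n)%N.
  rewrite ltnNge; apply/negP => n8; have [] := G n%:Z 0 _ _ _ => //.
  - by rewrite /rlat mul0r addr0 dvdz_mulr.
  - lia.
have nj : ~~ (n%:Z %| j)%Z.
  by apply/negP => nj; have [] := G 1 0 _ _ _ => //; rewrite /rlat mul0r addr0 mul1r.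
have nk : ~~ (n%:Z %| k)%Z.
  by apply/negP => nk; have [] := G 0 1 _ _ _ => //; rewrite /rlat mul0r add0r mul1r.
have [j1 [s [j10 j1n jE]]] := small_residue n0 nj.
have [k1 [t [k10 k1n kE]]] := small_residue n0 nk.
have E : rlat n j k =2 alat n (s != t, false) j1 k1.
  by move=> x y; rewrite (rlat_congr jE kE) alat_sg.
have n3 : (3 <= n)%N by apply: leq_trans n8.
case: (leqP j1 k1) => jk.
  by exists j1, k1, (s != t, false); split=> //; apply/and5P.
exists k1, j1, (s != t, true); split; first by apply/and5P; split=> //; exact: ltnW.
by move=> x y; rewrite alat_swap.
Qed.

Lemma Lgood_alat n e (j k : int) : Lgood (alat n e j k) -> Lgood (rlat n j k).
Proof.
move=> G x y x8 y8 L.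
have bd s (z : int) : `|z| <= 8 -> `|z *~ sg s| <= 8 by case: s; rewrite mulr_sg // normrN.
have z0 s (z : int) : z *~ sg s = 0 -> z = 0 by case: s; rewrite mulr_sg //; lia.
have sK s (z : int) : z *~ sg s *~ sg s = z by case: s; rewrite !mulr_sg ?opprK.
case: e G => s [] G.
  have [] := G y (x *~ sg s) y8 (bd s x x8); first by rewrite alatE /= sK.
  by move=> -> /z0.
have [] := G (x *~ sg s) y (bd s x x8) y8; first by rewrite alatE /= sK.
by move=> /z0.
Qed.

Notation trip N := (('I_N.+1 * 'I_N.+1) * 'I_N.+1)%type.

Definition plat N (t : trip N) (e : bool * bool) : int -> int -> bool :=
  alat t.1.1 e t.1.2 t.2.

(** [x] is the Hermite form of the lattice of [t] twisted by [e]; each admissible pair [(t, e)] has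
    exactly one. *)
Definition encodes N (t : trip N) e (x : tok N) : Prop :=
  toksize x = t.1.1 /\ tlat x =2 plat t e.

Notation classes N := (equivalence_partition (@Igraph_isob N) (Iparams N)).

Lemma Iparams_size N (t : trip N) : t \in Iparams N -> (0 < t.1.1)%N.
Proof. by rewrite inE => /and5P[n3 _ _ _ _]; exact: leq_trans n3. Qed.

Lemma classes_sub N (B : {set trip N}) t : B \in classes N -> t \in B -> t \in Iparams N.
Proof. by case/imsetP => x _ ->; rewrite inE => /andP[]. Qed.

Lemma classes_iso N (B : {set trip N}) t t' : B \in classes N ->
  t \in B -> t' \in B -> Igraph_isob t t'.
Proof.
have /equivalence_relP[refl trans] := @Igraph_isob_equiv N.
case/imsetP => x _ ->; rewrite inE => /andP[_ xt]; rewrite inE => /andP[_ xt'].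
by rewrite -(trans _ _ xt).
Qed.

Lemma classes_eq N (B B' : {set trip N}) t t' : B \in classes N -> B' \in classes N ->
  t \in B -> t' \in B' -> Igraph_isob t t' -> B = B'.
Proof.
have /equivalence_relP[refl trans] := @Igraph_isob_equiv N.
case/imsetP => x _ ->; case/imsetP => x' _ ->.
rewrite inE => /andP[_ xt]; rewrite inE => /andP[_ xt'] tt'.
apply/setP => y; rewrite [LHS]inE [RHS]inE; congr andb.
by rewrite (trans _ _ xt) (trans _ _ tt') -(trans _ _ xt').
Qed.

Lemma classes_rep N : {r : {set trip N} -> trip N & forall B, B \in classes N -> r B \in B}.
Proof.
apply: (@choice _ _ (fun (B : {set trip N}) t => B \in classes N -> t \in B)) => B.
have [BC|nBC] := boolP (B \in classes N); last by exists ((ord0, ord0), ord0).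
case/imsetP: (BC) => x xP BE; exists x => _.
have /equivalence_relP[refl _] := @Igraph_isob_equiv N.
by rewrite BE inE xP refl.
Qed.

Lemma encodes_inj N (t : trip N) e (x x' : tok N) : x \in hnfs N -> x' \in hnfs N ->
  encodes t e x -> encodes t e x' -> x = x'.
Proof.
rewrite !inE => /and5P[m0 a0 bc _ _] /and5P[m0' a0' bc' _ _] [sx lx] [sx' lx'].
have [aE bE cE] : [/\ x.1.2 = x'.1.2 :> nat, x.2.2 = x'.2.2 :> nat & x.2.1 = x'.2.1 :> nat].
  by apply: hlat_inj => // u v; have := lx u v; rewrite -lx'.
have mE : x.1.1 = x'.1.1 :> nat.
  move: sx; rewrite -sx' /toksize aE cE => /eqP.
  by rewrite -!mulnA eqn_pmul2r ?muln_gt0 ?a0' ?(leq_ltn_trans _ bc') // => /eqP.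
case: x x' aE bE cE mE {m0 a0 bc m0' a0' bc' sx lx sx' lx'} => [[m a] [c b]] [[m' a'] [c' b']] /=.
by move=> /val_inj-> /val_inj-> /val_inj-> /val_inj->.
Qed.

Lemma encodes_ex N (t : trip N) e : t \in Iparams N ->
  exists2 x, x \in hnfs N & encodes t e x.
Proof.
move=> tP; have n0 := Iparams_size tP.
have [m [a [b [c [[m0 a0 bc] nE g1 L]]]]] := rlat_hnf
  (act e (t.1.2%:Z, t.2%:Z)).1 (act e (t.1.2%:Z, t.2%:Z)).2 n0.
have c0 : (0 < c)%N by exact: leq_ltn_trans bc.
have nN : (m * a * c < N.+1)%N by rewrite nE.
have mN : (m < N.+1)%N by apply: leq_ltn_trans nN; rewrite -mulnA leq_pmulr // muln_gt0 a0.
have aN : (a < N.+1)%N.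
  by apply: leq_ltn_trans nN; rewrite -mulnA mulnCA leq_pmulr // muln_gt0 m0.
have cN : (c < N.+1)%N by apply: leq_ltn_trans nN; rewrite leq_pmull // muln_gt0 m0.
have bN : (b < N.+1)%N by exact: ltn_trans cN.
exists ((Ordinal mN, Ordinal aN), (Ordinal cN, Ordinal bN)).
  by rewrite inE /= m0 a0 bc g1 eqxx andbT.
by split=> // u v; rewrite /tlat /plat /alat L.
Qed.

Lemma good_encoded N (x : tok N) : x \in hnfs N -> Lgood (tlat x) ->
  exists2 t, t \in Iparams N & exists e, encodes t e x.
Proof.
rewrite inE => /and5P[m0 a0 bc macN /eqP g1] G.
have c0 : (0 < x.2.1)%N by exact: leq_ltn_trans bc.
have n0 : (0 < toksize x)%N by rewrite !muln_gt0 m0 a0.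
have [j [k L]] := hnf_realized m0 a0 c0 g1.
have G' : Lgood (rlat (toksize x) j k) by apply: Lgood_eq G => u v; rewrite L.
have [j1 [k1 [e [P E]]]] := good_params n0 G'.
have nN : (toksize x < N.+1)%N by [].
have kN : (k1 < N.+1)%N by case/and5P: P => _ _ kn _ _; lia.
have jN : (j1 < N.+1)%N by case/and5P: P => _ _ _ _ jk; lia.
exists ((Ordinal nN, Ordinal jN), Ordinal kN); first by rewrite inE.
by exists e; split=> // u v; rewrite /plat /= -E L.
Qed.

(** Every good form comes from the representative of some class under one of the four symmetries. *)
Lemma CI_lower N : (#|hnfs N :\: bads N| <= 4 * CI N)%N.
Proof.
pose good (t : trip N) := `[< Lgood (rlat t.1.1 t.1.2 t.2) >].
(* [alat_of_Igraph_iso] wants both lattices good, so the representative is chosen good whenever the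
   class contains a good triple. *)
pose r (B : {set trip N}) := odflt ((ord0, ord0), ord0) [pick t in B | good t].
pose F (i : {set trip N} * (bool * bool)) := [set x in hnfs N | `[< encodes (r i.1) i.2 x >]].
have -> : (4 * CI N = 1 * #|finset.setX (classes N) [set: bool * bool]|)%N.
  by rewrite cardsX cardsT card_prod !card_bool mul1n mulnC.
apply: (card_le_cover (F := F)) => [x|i _]; last first.
  apply/card_le1P => x; rewrite inE => /andP[xX /asboolP ex] x'.
  rewrite [RHS]inE [LHS]inE; apply/andP/eqP => [[x'X /asboolP ex']|->]; first exact: encodes_inj ex' ex.
  by split=> //; exact/asboolP.
rewrite inE => /andP[nbad xX].
have G : Lgood (tlat x).
  by move: nbad; rewrite inE xX /= negbK => /asboolP.
have [t tP [e [sx lx]]] := good_encoded (x := x) xX G.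
have Gt : Lgood (rlat t.1.1 t.1.2 t.2).
  by apply: (@Lgood_alat _ e); apply: Lgood_eq G.
pose B := [set y in Iparams N | Igraph_isob t y].
have /equivalence_relP[refl _] := @Igraph_isob_equiv N.
have BC : B \in classes N by apply/imsetP; exists t.
have tB : t \in B by rewrite inE tP refl.
have [rB Gr] : r B \in B /\ Lgood (rlat (r B).1.1 (r B).1.2 (r B).2).
  rewrite /r; case: pickP => [y /andP[yB /asboolP Gy]|/(_ t)]; first by [].
  by rewrite tB /good /=; move/asboolP.
have iso : graph_iso (Igraph t.1.1 t.1.2 t.2) (Igraph (r B).1.1 (r B).1.2 (r B).2).
  exact/asboolP/(classes_iso BC).
have nE := Igraph_iso_size iso; rewrite -nE in iso Gr.
have [h hE] := alat_of_Igraph_iso (Iparams_size tP) Gt Gr iso.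
have [h' hE'] := alat_closed t.1.1 e h (r B).1.2 (r B).2.
exists (B, h'); first by rewrite !inE BC.
rewrite inE xX; apply/asboolP; split; first by rewrite sx nE.
move=> u v; rewrite lx /plat /= -nE -hE' /alat.
suff act_rlat (p q : int * int) : rlat t.1.1 p.1 p.2 =2 rlat t.1.1 q.1 q.2 ->
    rlat t.1.1 (act e p).1 (act e p).2 =2 rlat t.1.1 (act e q).1 (act e q).2.
  by apply: act_rlat => ? ?; rewrite hE.
by case: p q => [p1 p2] [q1 q2] /= E ? ?; rewrite -/(alat _ _ _ _) -/(alat _ e q1 q2) !alatE !E.
Qed.

(** Equal lattices give isomorphic graphs, so different classes have different forms. An asymmetric
    representative has four forms by [alat_inj]; the remaining classes inject into [fixs]. *)
Lemma CI_upper N : (4 * CI N <= #|hnfs N| + 4 * #|fixs N|)%N.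
Proof.
have [r rP] := classes_rep N.
pose isfix (B : {set trip N}) := `[< Lfix (rlat (r B).1.1 (r B).1.2 (r B).2) >].
pose C1 := [set B in classes N | ~~ isfix B]; pose C2 := [set B in classes N | isfix B].
have same B B' e e' x : B \in classes N -> B' \in classes N ->
    encodes (r B) e x -> encodes (r B') e' x -> B = B'.
  move=> BC BC' [sx lx] [sx' lx']; apply: (classes_eq BC BC' (rP _ BC) (rP _ BC')).
  apply/asboolP; rewrite -sx -sx'; apply: (@Igraph_iso_of_alat _ _ _ _ _ e e').
    by rewrite sx (Iparams_size (classes_sub BC (rP _ BC))).
  by move=> u v; have := lx u v; rewrite lx' /plat -sx -sx'.
have cI : CI N = (#|C1| + #|C2|)%N.
  rewrite /CI -(cardsID C2 (classes N)) addnC; congr (_ + _)%N; apply: eq_card => B; rewrite !inE.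
    by case: (B \in classes N); rewrite ?andbT.
  by case: (B \in classes N).
have H1 : (4 * #|C1| <= #|hnfs N|)%N.
  have -> : (4 * #|C1| = #|finset.setX C1 [set: bool * bool]|)%N.
    by rewrite cardsX cardsT card_prod !card_bool mulnC.
  rewrite -[X in (_ <= X)%N]mul1n.
  apply: (card_le_cover (F := fun x => [set i in finset.setX C1 [set: bool * bool] |
     `[< encodes (r i.1) i.2 x >]])) => [[B e]|x _].
    move=> BeC; have := BeC; rewrite finset.in_setX => /andP[+ _]; rewrite inE => /andP[BC _].
    have [x xX ex] := encodes_ex e (classes_sub BC (rP _ BC)).
    by exists x => //; rewrite inE BeC; exact/asboolP.
  apply/card_le1P => -[B e]; rewrite inE => /andP[BC1 /asboolP ex] [B' e'].
  rewrite [RHS]inE [LHS]inE; apply/andP/eqP => [[BC1' /asboolP ex']|[-> ->]]; last by split=> //; exact/asboolP.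
  have := BC1; rewrite finset.in_setX => /andP[+ _]; rewrite inE => /andP[BC nf].
  have := BC1'; rewrite finset.in_setX => /andP[+ _]; rewrite inE => /andP[BC' _].
  have BB := same _ _ _ _ _ BC' BC ex' ex; rewrite /= in ex ex' BB.
  rewrite BB in ex' *; congr pair.
  apply: (@alat_inj (r B).1.1 _ _ (r B).1.2 (r B).2); first exact/asboolPn.
  by move=> u v; have := ex'.2 u v; rewrite (ex.2 u v).
have H2 : (#|C2| <= #|fixs N|)%N.
  rewrite -[X in (_ <= X)%N]mul1n.
  apply: (card_le_cover (F := fun x => [set B in C2 |
     `[< encodes (r B) (false, false) x >]])) => [B|x _].
    move=> BC2; have := BC2; rewrite inE => /andP[BC /asboolP Bf].
    have [x xX ex] := encodes_ex (false, false) (classes_sub BC (rP _ BC)).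
    have xL u v : tlat x u v = rlat (r B).1.1 (r B).1.2 (r B).2 u v.
      by rewrite ex.2 /plat alatE /= mulr_sg.
    exists x; last by rewrite inE BC2; exact/asboolP.
    rewrite inE xX; apply/asboolP.
    by case: Bf => H; [apply: Or31 | apply: Or32 | apply: Or33] => u v; rewrite !xL.
  apply/card_le1P => B; rewrite inE => /andP[BC2 /asboolP ex] B'.
  rewrite [RHS]inE [LHS]inE; apply/andP/eqP => [[BC2' /asboolP ex']|->]; last by split=> //; exact/asboolP.
  have := BC2; rewrite inE => /andP[BC _]; have := BC2'; rewrite inE => /andP[BC' _].
  exact: same ex' ex.
by rewrite cI mulnDr leq_add // leq_mul2l.
Qed.

(** * Passage to the limit *)

Section Limit.
Variable R : realType.

Lemma CI_small : small (fun N => (CI N)%:R - 5 / 16 * N%:R ^+ 2 : R).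
Proof.
have S1 := smallZ (1 / 4) (@card_hnfs_small R).
(* 578 = 2312 / 4 comes from the lower bound; the upper bound asks only for 4 * 6 / 4 = 6. *)
have S2 := smallZ 578 (@card_facs_small R).
apply: (@eq_small _ (fun N => 1 / 4 * (#|hnfs N|%:R - 5 / 4 * N%:R ^+ 2) +
  ((CI N)%:R - 1 / 4 * #|hnfs N|%:R))) => [N|]; first by field.
apply: smallD S1 _; apply: small_le S2 => N _.
have L := CI_lower N; have U := CI_upper N; have F := card_fixs N; have B := card_bads N.
have D : (#|hnfs N| <= #|hnfs N :\: bads N| + #|bads N|)%N.
  by rewrite -(cardsID (bads N) (hnfs N)) addnC leq_add2l subset_leq_card // subsetIr.
have {}L : (#|hnfs N| <= 4 * CI N + 2312 * #|facs N|)%N by lia.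
have {}U : (4 * CI N <= #|hnfs N| + 24 * #|facs N|)%N by lia.
have Lr : #|hnfs N|%:R <= 4 * (CI N)%:R + 2312 * #|facs N|%:R :> R.
  by rewrite -!natrM -natrD ler_nat.
have Ur : 4 * (CI N)%:R <= #|hnfs N|%:R + 24 * #|facs N|%:R :> R.
  by rewrite -!natrM -natrD ler_nat.
have f0 : 0 <= #|facs N|%:R :> R by [].
by rewrite [leRHS]ger0_norm ?mulr_ge0 // ler_norml; apply/andP; split; lra.
Qed.

Lemma small_cvg (u : nat -> R) (l : R) : 0 < l ->
  small (fun N => u N - l * N%:R ^+ 2) -> asymp_equiv u (fun N => l * N%:R ^+ 2).
Proof.
move=> l0 su; apply/cvgrPdist_le => /= e e0.
have el0 : 0 < l * e / 2 by rewrite divr_gt0 ?mulr_gt0.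
have [K K0 H] := su _ el0.
(* Beyond this bound the linear term is at most the second half of the tolerance,
   [l * e / 2 * N ^ 2]. *)
pose M := Num.bound (2 * K / (l * e)).
have q0 : 0 <= 2 * K / (l * e) by rewrite divr_ge0 ?mulr_ge0 // ltW.
have HM := archi_boundP q0; rewrite -/M in HM.
exists M.+1 => // N /= MN.
have N0 : (0 < N)%N by exact: leq_trans MN.
have N0' : (0 : R) < N%:R by rewrite ltr0n.
have MN' : M%:R <= N%:R :> R by rewrite ler_nat ltnW.
have P0 : 0 < l * N%:R ^+ 2 by rewrite mulr_gt0 ?exprn_gt0.
have -> : 1 - u N / (l * N%:R ^+ 2) = - (u N - l * N%:R ^+ 2) / (l * N%:R ^+ 2).
  by field; rewrite !gt_eqF.
rewrite normrM normrN normfV (gtr0_norm P0) ler_pdivrMr //.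
apply: le_trans (H N N0) _.
have KN : 2 * K <= N%:R * (l * e).
  by rewrite -ler_pdivrMr ?mulr_gt0 // (le_trans (ltW HM)).
have : 2 * K * N%:R <= N%:R * (l * e) * N%:R by rewrite ler_wpM2r // ltW.
rewrite expr2; move: (N%:R : R) => x; lra.
Qed.
End Limit.

Theorem theorem3 (R : realType) :
  asymp_equiv (fun N : nat => (CI N)%:R : R)
              (fun N : nat => (5%:R / 16%:R) * N%:R ^+ 2 : R).
Proof. by apply: small_cvg; [lra | exact: CI_small]. Qed.
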